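(* Let $\rho>0$, let $(x_1,y_1),(x_2,y_2)\in\mathbb{R}^2$ be two targets, let $\theta_d$ be a given departure angle at target 1, and let $\Theta_2=[\theta_2^{min},\theta_2^{max}]\subseteq[0,2\pi]$ with $\theta_2^{min}<\theta_2^{max}$. Consider all paths from $(x_1,y_1)$ to $(x_2,y_2)$ that are $C^1$ and piecewise $C^2$, whose radius of curvature is at least $\rho$ at every point, whose departure angle at target 1 is $\theta_d$ and whose arrival angle $\theta_a$ at target 2 lies in $\Theta_2$. Then any shortest path among these must be one of the following, or a degenerate form of one of these: 1. The path is either $LS$ or $RS$ or $LR_\psi$ or $RL_\psi$ with $\psi>\pi$. 2. $\theta_a=\theta_2^{max}$ and the path is either $LSR$ or $RSR$ or $RL_\psi R$ with $\psi>\pi$. 3. $\theta_a=\theta_2^{min}$ and the path is either $RSL$ or $LSL$ or $LR_\psi L$ with $\psi>\pi$.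
   Context: Angles (headings) are measured from the positive $x$-axis, counterclockwise positive; a heading is a direction of travel, so it is identified modulo $2\pi$ and lies in $\Theta_2$ if it has a representative in $\Theta_2\subseteq[0,2\pi]$. The departure angle is the heading of the path at its start, the arrival angle the heading at its end. Path types: $L$ denotes a circular arc of radius $\rho$ traversed counterclockwise, $R$ a circular arc of radius $\rho$ traversed clockwise, and $S$ a straight line segment. A word such as $LSR$ denotes the ($C^1$) concatenation of the segments in the given order. A subscript, as in $L_\psi$ or $R_\psi$, indicates the angle of turn $\psi$ of that arc. A degenerate form of a path type is one obtained by letting one or more of its segments have zero length, i.e. deleting them; e.g. the degenerate forms of $RSL$ are $S$, $L$, $R$, $RS$, $SL$ and $RL$. Subscripted arcs that are retained keep their stated condition on $\psi$. *)

(* Defs.v *)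
From Stdlib Require Import Reals List.
Import ListNotations.
Local Open Scope R_scope.

Definition deriv_on (a b : R) (f f' : R -> R) : Prop :=
  forall t, a <= t <= b -> D_in f f' (fun s => a <= s <= b) t.

Definition cont_on (a b : R) (f : R -> R) : Prop :=
  forall t, a <= t <= b -> continue_in f (fun s => a <= s <= b) t.

(* Plane paths are parametrised by arc length on [0, len]; the unit-speed
   requirement is part of [admissible].  The values of [px] and [py] outside
   [0, len] play no role: every derivative below is relative to an interval
   contained in [0, len], hence one-sided at its end points. *)
Record path : Type := mkPath { len : R; px : R -> R; py : R -> R }.

(* [theta] is a heading of [p] at time [t]: the velocity is the unit vector of
   angle [theta].  Headings are determined modulo 2 PI only. *)
Definition heading (p : path) (t theta : R) : Prop :=
  D_in (px p) (fun _ => cos theta) (fun s => 0 <= s <= len p) t /\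
  D_in (py p) (fun _ => sin theta) (fun s => 0 <= s <= len p) t.

Definition unit_speed (p : path) : Prop :=
  forall t, 0 <= t <= len p -> exists theta, heading p t theta.

Definition C1 (p : path) : Prop :=
  exists u v : R -> R,
    deriv_on 0 (len p) (px p) u /\ cont_on 0 (len p) u /\
    deriv_on 0 (len p) (py p) v /\ cont_on 0 (len p) v.

(* On [a, b] the path is C^2 (one-sidedly at the end points) and its radius of
   curvature, the inverse of the curvature
   |x' y'' - y' x''| / (x'^2 + y'^2)^(3/2), is at least [rho]; the denominator
   is 1 for unit speed, and curvature 0 means infinite radius. *)
Definition C2_radius_ge (rho : R) (p : path) (a b : R) : Prop :=
  exists u v u' v' : R -> R,
    deriv_on a b (px p) u /\ deriv_on a b u u' /\ cont_on a b u' /\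
    deriv_on a b (py p) v /\ deriv_on a b v v' /\ cont_on a b v' /\
    forall t, a <= t <= b -> Rabs (u t * v' t - v t * u' t) <= / rho.

(* At a break point both one-sided radii of curvature are bounded below. *)
Definition piecewise_C2_radius_ge (rho : R) (p : path) : Prop :=
  exists (n : nat) (s : nat -> R),
    s 0%nat = 0 /\ s n = len p /\
    forall i, (i < n)%nat ->
      s i < s (S i) /\ C2_radius_ge rho p (s i) (s (S i)).

(* The length is required to be positive: a path reduced to a point has no
   direction of travel. *)
Definition admissible (rho x1 y1 x2 y2 theta_d theta_min theta_max : R)
    (p : path) : Prop :=
  0 < len p /\ unit_speed p /\ C1 p /\ piecewise_C2_radius_ge rho p /\
  px p 0 = x1 /\ py p 0 = y1 /\ px p (len p) = x2 /\ py p (len p) = y2 /\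
  heading p 0 theta_d /\
  exists theta_a, theta_min <= theta_a <= theta_max /\ heading p (len p) theta_a.

Definition shortest (rho x1 y1 x2 y2 theta_d theta_min theta_max : R)
    (p : path) : Prop :=
  admissible rho x1 y1 x2 y2 theta_d theta_min theta_max p /\
  forall q, admissible rho x1 y1 x2 y2 theta_d theta_min theta_max q ->
    len p <= len q.

(* Letters of path types.  The argument of an arc is the condition imposed on
   its angle of turn (its subscript). *)
Inductive letter : Type :=
| arcL (c : R -> Prop)
| arcR (c : R -> Prop)
| lineS.

Definition Lt : letter := arcL (fun _ => True).
Definition Rt : letter := arcR (fun _ => True).
Definition St : letter := lineS.
Definition Lt_gtPI : letter := arcL (fun psi => PI < psi).
Definition Rt_gtPI : letter := arcR (fun psi => PI < psi).

Definition is_segment (rho : R) (p : path) (a b : R) (l : letter) : Prop :=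
  match l with
  | arcL c => c ((b - a) / rho) /\
      exists cx cy phi, forall t, a <= t <= b ->
        px p t = cx + rho * cos (phi + (t - a) / rho) /\
        py p t = cy + rho * sin (phi + (t - a) / rho)
  | arcR c => c ((b - a) / rho) /\
      exists cx cy phi, forall t, a <= t <= b ->
        px p t = cx + rho * cos (phi - (t - a) / rho) /\
        py p t = cy + rho * sin (phi - (t - a) / rho)
  | lineS =>
      exists theta, forall t, a <= t <= b ->
        px p t = px p a + (t - a) * cos theta /\
        py p t = py p a + (t - a) * sin theta
  end.

(* From time [a] to its end, [p] is the concatenation of segments of positive
   length of the kinds listed in [w].  Smoothness of the concatenation is not
   repeated here: it is the [C1] clause of [admissible]. *)
Fixpoint spells (rho : R) (p : path) (a : R) (w : list letter) : Prop :=
  match w with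
  | [] => a = len p
  | l :: w' => exists b, a < b /\ is_segment rho p a b l /\ spells rho p b w'
  end.

Inductive subword : list letter -> list letter -> Prop :=
| subword_nil : subword [] []
| subword_keep l w w' : subword w w' -> subword (l :: w) (l :: w')
| subword_delete l w w' : subword w w' -> subword w (l :: w').

(* [p] is of type [w] or of a degenerate form of [w].  A path of positive
   length never spells the empty word, so at least one segment is retained. *)
Definition of_type_or_degenerate (rho : R) (p : path) (w : list letter) : Prop :=
  exists w', subword w' w /\ spells rho p 0 w'.

(* Main.v *)
(** Only the time that a path spends at each heading matters: the displacement is
   the integral of the unit vectors of its headings, and a path of curvature at
   most [1 / rho] spends at least [rho] times the angle on every pass over an
   interval of headings.  A path is shortened by moving time between headings.

   Where the curvature of a C^2 piece is strictly between 0 and [1 / rho], the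
   excess time over an arc of radius [rho] goes into one straight segment at an
   intermediate heading, which is strictly shorter; hence every piece is an arc of
   radius [rho] or a segment, and a shortest path is a finite word in L, R, S.
   Words that are not of the listed types are shortened by cutting off the peak
   or valley of the heading between two arcs, or the end of the path if its
   heading may move, and by spending the time saved at a heading in between (or,
   when the turn exceeds [PI], by letting the heading overshoot before the turn). *)
Require Import Defs.
From Stdlib Require Import Reals ZArith List Lra Lia.
Import ListNotations.
Local Open Scope R_scope.

(** * Words in arcs and segments of unit radius *)

(** A shortening has two halves: a place where time [c] can be removed at the loss of a vector of
    length [r <= c], and a way to restore the loss in less time. The first half is isolated in
    [trimmable]. It treats alike the three things that can follow a left turn: a line, a right turn,
    or the end of the path when the arrival heading may decrease. So the same lemmas bound the
    number of segments, where the next segment supplies the trim, and restrict the last segments,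
    where the arrival heading supplies it.

    For the second half, a lost vector either goes back at its own heading, and then the gain is
    that of a chord over its arc, or is merged with another of equal length into one vector on the
    bisecting heading. The merging needs an angle of at most [PI] between the two; this is the
    source of the conditions on [psi].

    At [theta_max] the arrival heading can only decrease, which trims a final left turn; at
    [theta_min] it can only increase, which trims a final right turn. Hence items 2 and 3 are mirror
    images, and in the interior both restrictions hold. *)

Inductive kind : Type := KL | KR | KS.

Definition seg : Type := (kind * R)%type.

Definition turn (s : seg) : R :=
  match fst s with KL => snd s | KR => - snd s | KS => 0 end.

Definition disp1 (th : R) (s : seg) : R :=
  match fst s with
  | KL => sin (th + snd s) - sin th
  | KR => sin th - sin (th - snd s)
  | KS => snd s * cos th
  end.

Fixpoint ang (l : list seg) : R :=
  match l with [] => 0 | s :: l' => turn s + ang l' end.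

Fixpoint tot (l : list seg) : R :=
  match l with [] => 0 | s :: l' => snd s + tot l' end.

(* The x-component of the displacement for initial heading [th]; the y-component is
   [disp (th - PI / 2)], so equality for all [th] is equality of displacements. *)
Fixpoint disp (th : R) (l : list seg) : R :=
  match l with [] => 0 | s :: l' => disp1 th s + disp (th + turn s) l' end.

Definition valid (l : list seg) : Prop := Forall (fun s => 0 <= snd s) l.

Lemma tot_nonneg (l : list seg) : valid l -> 0 <= tot l.
Proof. intros Hv. induction Hv; simpl; lra. Qed.

(* The final heading may decrease by at most [e]; [e = 0] fixes it. *)
Definition improvable (e : R) (l : list seg) : Prop :=
  exists l', valid l' /\ 0 < tot l' < tot l /\
    (forall th, disp th l' = disp th l) /\ ang l - e <= ang l' <= ang l.

(* Arbitrarily little of the end of a left turn followed by [l] can be cut off: it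
   takes time [c] and contributes the vector of length [r] and heading
   [th + psi - d / 2]. *)
Definition trimmable (lt : R -> R -> Prop) (e : R) (l : list seg) : Prop :=
  forall b, 0 < b -> exists d r c l',
    valid l' /\ 0 <= d <= b /\ 0 < r <= b /\ lt r c /\
    (forall th psi, disp th ((KL, psi) :: l) =
       disp th ((KL, psi - d) :: l') + r * cos (th + psi - d / 2)) /\
    tot l = tot l' - d + c /\ ang l - e <= ang l' - d <= ang l.

Ltac valid_tac :=
  unfold valid in *; repeat (apply Forall_cons; [simpl; try lra |]);
  try apply Forall_nil; try assumption.

Lemma sin_minus_sin (x y : R) :
  sin x - sin y = 2 * sin ((x - y) / 2) * cos ((x + y) / 2).
Proof.
rewrite form4. ring.
Qed.

Lemma cos_plus_cos (x y : R) :
  cos x + cos y = 2 * cos ((x - y) / 2) * cos ((x + y) / 2).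
Proof. rewrite form1. ring. Qed.

(** * What can be cut off at the end of a left turn *)

Lemma trimmable_weaken (e : R) (l : list seg) :
  trimmable Rlt e l -> trimmable Rle e l.
Proof.
intros H b Hb. destruct (H b Hb) as (d & r & c & l' & H1 & H2 & H3 & H4 & H5).
exists d, r, c, l'. repeat split; try tauto; lra.
Qed.

(** The line has the final heading of the turn, so nothing of the turn is lost ([d = 0]); time on a
    line equals the length of its vector, so the comparison is not strict. *)
Lemma trimmable_line (e b : R) : 0 <= e -> 0 < b -> trimmable Rle e [(KS, b)].
Proof.
intros He Hb b0 Hb0.
assert (Hm := Rmin_l b b0). assert (Hm' := Rmin_r b b0).
assert (0 < Rmin b b0) by (apply Rmin_pos; assumption).
exists 0, (Rmin b b0), (Rmin b b0), [(KS, b - Rmin b b0)].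
repeat split; simpl; try lra.
- valid_tac.
- intros th psi. unfold disp1, turn; simpl.
  replace (psi - 0) with psi by ring. replace (th + psi - 0 / 2) with (th + psi) by field.
  ring.
- simpl; unfold turn; simpl; lra.
- simpl; unfold turn; simpl; lra.
Qed.

(** Lowering the peak of the heading by [d] removes two arcs over the same headings: time [2 * d],
    and twice their common chord [2 * sin (d / 2)], which points along the middle heading. *)
Lemma trimmable_peak (e x : R) : 0 <= e -> 0 < x -> trimmable Rlt e [(KR, x)].
Proof.
intros He Hx b Hb. assert (HPI := PI_RGT_0).
(* [d <= x] leaves a right turn, [d <= b / 2] gives [r < 2 * d <= b], and [d <= 1] makes
   [sin (d / 2)] positive. *)
set (d := Rmin (Rmin x (b / 2)) 1).
assert (Hd : 0 < d) by (unfold d; repeat apply Rmin_pos; lra).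
assert (Hd1 : d <= 1) by apply Rmin_r.
assert (Hdx : d <= x) by (eapply Rle_trans; [apply Rmin_l | apply Rmin_l]).
assert (Hdb : d <= b / 2) by (eapply Rle_trans; [apply Rmin_l | apply Rmin_r]).
assert (P2 := PI2_1).
assert (Hs : 0 < sin (d / 2)) by (apply sin_gt_0; lra).
assert (Hs' : sin (d / 2) < d / 2) by (apply sin_lt_x; lra).
exists d, (4 * sin (d / 2)), (2 * d), [(KR, x - d)].
repeat split; simpl; try lra.
- valid_tac.
- intros th psi. unfold disp1, turn; simpl.
  replace (th + (psi - d) - (x - d)) with (th + psi - x) by ring.
  assert (E := sin_minus_sin (th + psi) (th + (psi - d))).
  replace ((th + psi - (th + (psi - d))) / 2) with (d / 2) in E by field.
  replace ((th + psi + (th + (psi - d))) / 2) with (th + psi - d / 2) in E by field.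
  lra.
- simpl; unfold turn; simpl; lra.
- simpl; unfold turn; simpl; lra.
Qed.

(** Only one arc is lost here, so the final heading drops by [d]; the allowance [e] pays for
    this. *)
Lemma trimmable_end (e : R) : 0 < e -> trimmable Rlt e [].
Proof.
intros He b Hb. assert (HPI := PI_RGT_0).
set (d := Rmin (Rmin e b) 1).
assert (Hd : 0 < d) by (unfold d; repeat apply Rmin_pos; lra).
assert (Hd1 : d <= 1) by apply Rmin_r.
assert (Hdx : d <= e) by (eapply Rle_trans; [apply Rmin_l | apply Rmin_l]).
assert (Hdb : d <= b) by (eapply Rle_trans; [apply Rmin_l | apply Rmin_r]).
assert (P2 := PI2_1).
assert (Hs : 0 < sin (d / 2)) by (apply sin_gt_0; lra).
assert (Hs' : sin (d / 2) < d / 2) by (apply sin_lt_x; lra).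
exists d, (2 * sin (d / 2)), d, [].
repeat split; simpl; try lra.
- constructor.
- intros th psi. unfold disp1, turn; simpl.
  assert (E := sin_minus_sin (th + psi) (th + (psi - d))).
  replace ((th + psi - (th + (psi - d))) / 2) with (d / 2) in E by field.
  replace ((th + psi + (th + (psi - d))) / 2) with (th + psi - d / 2) in E by field.
  lra.
Qed.

(** * Displacement identities *)

Lemma disp_S (th m : R) l : disp th ((KS, m) :: l) = m * cos th + disp th l.
Proof. simpl. unfold disp1, turn; simpl. now rewrite Rplus_0_r. Qed.

Lemma disp_LL (th x y : R) l :
  disp th ((KL, x) :: (KL, y) :: l) = disp th ((KL, x + y) :: l).
Proof.
simpl. unfold disp1, turn; simpl. rewrite <- !Rplus_assoc. ring.
Qed.

Lemma disp_RR (th x y : R) l :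
  disp th ((KR, x) :: (KR, y) :: l) = disp th ((KR, x + y) :: l).
Proof.
simpl. unfold disp1, turn; simpl.
replace (th + - (x + y)) with (th + - x + - y) by ring.
replace (th - (x + y)) with (th - x - y) by ring.
replace (th + - x - y) with (th - x - y) by ring.
replace (th + - x) with (th - x) by ring.
ring.
Qed.

Lemma disp_LSL (th x m y : R) l :
  disp th ((KL, x) :: (KS, m) :: (KL, y) :: l) =
  m * cos (th + x) + disp th ((KL, x + y) :: l).
Proof.
rewrite <- disp_LL. simpl. unfold disp1, turn; simpl. rewrite !Rplus_0_r. ring.
Qed.

Lemma disp_RSR (th x m y : R) l :
  disp th ((KR, x) :: (KS, m) :: (KR, y) :: l) =
  m * cos (th - x) + disp th ((KR, x + y) :: l).
Proof.
rewrite <- disp_RR. simpl. unfold disp1, turn; simpl. rewrite !Rplus_0_r. unfold Rminus. ring.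
Qed.

(** Two vectors of length [r] at headings [2 * x] apart add up along the bisector. When [cos x < 1],
    one line there is shorter than the two together; this is the gain for turns up to [PI]. *)
Lemma two_pow_cos (th x r : R) :
  r * cos th + r * cos (th + 2 * x) = 2 * r * cos x * cos (th + x).
Proof.
assert (E := cos_plus_cos (th + 2 * x) th).
replace ((th + 2 * x - th) / 2) with x in E by field.
replace ((th + 2 * x + th) / 2) with (th + x) in E by field.
rewrite <- Rmult_plus_distr_l, Rplus_comm with (r1 := cos th), E. ring.
Qed.

Lemma disp_cons (th : R) (s : seg) (l : list seg) :
  disp th (s :: l) = disp1 th s + disp (th + turn s) l.
Proof. reflexivity. Qed.

Lemma disp_valley (th a y eta : R) (l : list seg) :
  disp th ((KR, a) :: (KL, y) :: l) =
  disp th ((KR, a - eta) :: (KL, y - eta) :: l) + 4 * sin (eta / 2) * cos (th - a + eta / 2).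
Proof.
simpl. unfold disp1, turn; simpl.
replace (th + - (a - eta) + (y - eta)) with (th + - a + y) by ring.
assert (E := sin_minus_sin (th - (a - eta)) (th - a)).
replace ((th - (a - eta) - (th - a)) / 2) with (eta / 2) in E by field.
replace ((th - (a - eta) + (th - a)) / 2) with (th - a + eta / 2) in E by field.
replace (th + - (a - eta)) with (th - (a - eta)) by ring.
replace (th + - a) with (th - a) by ring.
lra.
Qed.

(** * Shortenings that use a trim *)

Lemma improvable_line_short (e a psi : R) (l : list seg) :
  0 < a -> 0 < psi <= PI -> trimmable Rle e l ->
  improvable e ((KS, a) :: (KL, psi) :: l).
Proof.
intros Ha Hpsi Ht.
destruct (Ht (Rmin a (psi / 2))) as (d & r & c & l' & Hv & Hd & Hr & Hrc & HD & Htot & Hang).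
{ apply Rmin_pos; lra. }
assert (Hm := Rmin_l a (psi / 2)). assert (Hm' := Rmin_r a (psi / 2)).
(* [2 * x] is the angle between the heading [th] of the line and that of the trimmed vector,
   [th + psi - d / 2]; the turn reaches the bisector after [x]. *)
set (x := (psi - d / 2) / 2).
assert (Hx : 0 < x) by (unfold x; lra).
assert (Hx' : x <= psi - d) by (unfold x; lra).
assert (Hx2 : x <= PI / 2) by (unfold x; lra).
assert (Hc : 0 <= cos x) by (apply cos_ge_0; lra).
assert (Hc1 : cos x < 1).
{ rewrite <- cos_0. apply cos_decreasing_1; lra. }
(* The line gives up [r], the trim at least [r], and less than [2 * r] replaces both; hence a trim
   with [Rle] suffices. *)
exists ((KS, a - r) :: (KL, x) :: (KS, 2 * r * cos x) :: (KL, psi - d - x) :: l').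
assert (0 <= tot l').
{ apply tot_nonneg; assumption. }
assert (0 <= 2 * r * cos x) by (apply Rmult_le_pos; lra).
assert (2 * r * cos x < 2 * r) by (rewrite <- (Rmult_1_r (2 * r)) at 2; apply Rmult_lt_compat_l; lra).
repeat split; simpl; try lra.
- valid_tac.
- intros th. change (disp th ((KS, a - r) :: (KL, x) :: (KS, 2 * r * cos x) :: (KL, psi - d - x) :: l') = disp th ((KS, a) :: (KL, psi) :: l)).
  rewrite !disp_S, disp_LSL, HD. replace (x + (psi - d - x)) with (psi - d) by ring.
  assert (E := two_pow_cos th x r). replace (th + 2 * x) with (th + psi - d / 2) in E by (unfold x; field).
  lra.
- simpl; unfold turn; simpl; lra.
- simpl; unfold turn; simpl; lra.
Qed.

(** Bounds the cost of an overshoot by [eta] in [improvable_line_long]: there [1 - cos eta] is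
    [- r * sin xi / 2], so [2 * (eta - sin eta) <= eta * r], which is small against [r]. *)
Lemma sin_sub_cos (x : R) : 0 <= x <= PI -> x - sin x <= x * (1 - cos x).
Proof.
intros Hx. enough (x * cos x <= sin x) by lra.
destruct (Req_dec x 0) as [->|Hx0].
{ rewrite sin_0; lra. }
destruct (MVT_cor2 (fun t => sin t - t * cos t) (fun t => t * sin t) 0 x) as (c & Hc & Hc').
- lra.
- intros c Hc.
  replace (c * sin c) with (cos c - (1 * cos c + c * - sin c)) by ring.
  apply derivable_pt_lim_minus. apply derivable_pt_lim_sin.
  apply (derivable_pt_lim_mult id cos). apply derivable_pt_lim_id. apply derivable_pt_lim_cos.
- rewrite sin_0 in Hc.
  assert (0 <= sin c) by (apply sin_ge_0; lra).
  assert (0 <= c * sin c * (x - 0)).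
  { apply Rmult_le_pos; [apply Rmult_le_pos|]; lra. }
  lra.
Qed.

(* Part of the segment and the end of the turn are exchanged for overshooting the
   heading of the segment by [eta] to the right.  The displacements agree iff
   [2 (1 - cos eta) = - r sin xi] and the segment is shortened by
   [2 sin eta - r cos xi]; the length increases by at most
   [2 (eta - sin eta) - r (1 - cos xi)], which is negative for small [eta]. *)
Lemma improvable_line_long (e a psi : R) (l : list seg) :
  0 < a -> PI < psi < 2 * PI -> trimmable Rle e l ->
  improvable e ((KS, a) :: (KL, psi) :: l).
Proof.
intros Ha Hpsi Ht. assert (P2 := PI2_1). assert (HPI := PI_RGT_0).
(* [kap] will bound [eta]. Being at most [1 - cos psi], it keeps the cost [eta * r] below the gain
   [r * (1 - cos xi)]; being at most [a / 4], it keeps [2 * sin eta] below half of the segment. *)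
set (kap := Rmin (Rmin (1 - cos psi) (a / 4)) 1).
assert (Hcp : cos psi < 1).
{ rewrite <- cos_2PI. apply cos_increasing_1; lra. }
assert (Hk : 0 < kap) by (unfold kap; repeat apply Rmin_pos; lra).
assert (Hk1 : kap <= 1) by apply Rmin_r.
assert (Hkc : kap <= 1 - cos psi) by (eapply Rle_trans; [apply Rmin_l | apply Rmin_l]).
assert (Hka : kap <= a / 4) by (eapply Rle_trans; [apply Rmin_l | apply Rmin_r]).
assert (Hck : cos kap < 1).
{ rewrite <- cos_0. apply cos_decreasing_1; lra. }
(* The three bounds keep [xi] beyond [PI], keep [- r * cos xi] within a quarter of the segment, and
   force [eta < kap]. *)
set (b := Rmin (Rmin (psi - PI) (a / 4)) (1 - cos kap)).
assert (Hb : 0 < b) by (unfold b; repeat apply Rmin_pos; lra).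
assert (Hbk : b <= 1 - cos kap) by apply Rmin_r.
assert (Hbp : b <= psi - PI) by (eapply Rle_trans; [apply Rmin_l | apply Rmin_l]).
assert (Hba : b <= a / 4) by (eapply Rle_trans; [apply Rmin_l | apply Rmin_r]).
destruct (Ht b Hb) as (d & r & c & l' & Hv & Hd & Hr & Hrc & HD & Htot & Hang).
set (xi := psi - d / 2).
assert (Hxi : PI < xi <= psi) by (unfold xi; lra).
assert (Hsx : sin xi < 0) by (apply sin_lt_0; lra).
assert (Hcx : cos xi <= cos psi).
{ destruct (Req_dec xi psi) as [->|]; [lra|]. left. apply cos_increasing_1; lra. }
assert (Hsx1 := SIN_bound xi). assert (Hcx1 := COS_bound xi).
set (eta := acos (1 + r * sin xi / 2)).
assert (B1 : - r <= r * sin xi).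
{ replace (- r) with (r * -1) by ring. apply Rmult_le_compat_l; lra. }
assert (B2 : r * sin xi < 0).
{ replace 0 with (r * 0) by ring. apply Rmult_lt_compat_l; lra. }
assert (Hce : cos eta = 1 + r * sin xi / 2).
{ assert (Hckb := COS_bound kap). apply cos_acos; lra. }
assert (He0 : 0 < eta).
{ destruct (acos_bound (1 + r * sin xi / 2)) as [[H|H] _]; [assumption|].
  exfalso. fold eta in H. rewrite <- H, cos_0 in Hce. lra. }
assert (Hepi : eta <= PI) by apply acos_bound.
assert (Hek : eta < kap).
{ apply cos_decreasing_0; lra. }
assert (Hse := sin_sub_cos eta ltac:(lra)).
assert (Hse2 : 2 * (eta - sin eta) <= eta * r).
{ replace (1 - cos eta) with (- (r * sin xi) / 2) in Hse by (rewrite Hce; field).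
  assert (eta * - (r * sin xi) <= eta * r) by (apply Rmult_le_compat_l; lra). lra. }
assert (Hse3 : eta * r < r * (1 - cos xi)).
{ rewrite Rmult_comm. apply Rmult_lt_compat_l; lra. }
assert (Hse4 : sin eta < eta) by (apply sin_lt_x; lra).
assert (B3 : - r <= r * cos xi).
{ replace (- r) with (r * -1) by ring. apply Rmult_le_compat_l; lra. }
set (m := 2 * sin eta - r * cos xi).
assert (Hma : m <= a) by (unfold m; lra).
assert (0 <= tot l').
{ apply tot_nonneg; assumption. }
exists ((KS, a - m) :: (KR, eta) :: (KL, eta + (psi - d)) :: l').
repeat split; simpl.
- valid_tac.
- lra.
- unfold m. lra.
- intros th.
  change (disp th ((KS, a - m) :: (KR, eta) :: (KL, eta + (psi - d)) :: l') = disp th ((KS, a) :: (KL, psi) :: l)).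
  rewrite !disp_S, HD.
  (* Going down to [th - eta] and back to [th] passes the same headings twice, whence the factor
     2. *)
  replace (disp th ((KR, eta) :: (KL, eta + (psi - d)) :: l'))
    with (2 * (sin th - sin (th - eta)) + disp th ((KL, psi - d) :: l')).
  2:{ simpl. unfold disp1, turn; simpl.
      replace (th + - eta + (eta + (psi - d))) with (th + (psi - d)) by ring.
      replace (th + - eta) with (th - eta) by ring. ring. }
  replace (th + psi - d / 2) with (th + xi) by (unfold xi; ring).
  rewrite cos_plus, sin_minus, Hce. unfold m. field.
- simpl; unfold turn; simpl; lra.
- simpl; unfold turn; simpl; lra.
Qed.

Lemma improvable_line (e a psi : R) (l : list seg) :
  0 < a -> 0 < psi < 2 * PI -> trimmable Rle e l ->
  improvable e ((KS, a) :: (KL, psi) :: l).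
Proof.
intros Ha Hpsi Ht. destruct (Rle_dec psi PI).
- apply improvable_line_short; lra || assumption.
- apply improvable_line_long; lra || assumption.
Qed.

(** The valley before the left turn takes the part of the line in [improvable_line_short]: it gives
    up a vector of length [r], which took time [2 * eta > r], and a line on the bisecting heading
    replaces this vector and the trimmed one. *)
Lemma improvable_arc_short (e a psi : R) (l : list seg) :
  0 < a -> 0 < psi <= PI -> trimmable Rle e l ->
  improvable e ((KR, a) :: (KL, psi) :: l).
Proof.
intros Ha Hpsi Ht. assert (P2 := PI2_1).
(* [h] bounds [eta], and [d] through [sin (h / 2)]; [psi / 8] is small enough for the bisector to
   lie in what remains of the left turn. *)
set (h := Rmin (Rmin a (psi / 8)) 1).
assert (Hh : 0 < h) by (unfold h; repeat apply Rmin_pos; lra).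
assert (Hh1 : h <= 1) by apply Rmin_r.
assert (Hha : h <= a) by (eapply Rle_trans; [apply Rmin_l | apply Rmin_l]).
assert (Hhp : h <= psi / 8) by (eapply Rle_trans; [apply Rmin_l | apply Rmin_r]).
assert (Hsh : 0 < sin (h / 2)) by (apply sin_gt_0; lra).
assert (Hsh1 := SIN_bound (h / 2)).
assert (Hsh' : sin (h / 2) < h / 2) by (apply sin_lt_x; lra).
destruct (Ht (sin (h / 2))) as (d & r & c & l' & Hv & Hd & Hr & Hrc & HD & Htot & Hang); [assumption|].
(* Solves [4 * sin (eta / 2) = r], so that valley and trim lose vectors of equal length. *)
set (eta := 2 * asin (r / 4)).
assert (Hsa : sin (asin (r / 4)) = r / 4) by (apply sin_asin; lra).
assert (Hab := asin_bound (r / 4)).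
assert (Heta0 : 0 < eta).
{ unfold eta. enough (0 < asin (r / 4)) by lra.
  apply sin_increasing_0; try lra. rewrite sin_0, Hsa. lra. }
assert (Hetah : eta < h).
{ unfold eta. enough (asin (r / 4) < h / 2) by lra.
  apply sin_increasing_0; lra. }
assert (Hreta : r < 2 * eta).
{ assert (asin (r / 4) > sin (asin (r / 4))). apply sin_lt_x. unfold eta in Heta0; lra.
  unfold eta. lra. }
set (x := (psi - d / 2 - eta / 2) / 2).
assert (Hx : 0 < x) by (unfold x; lra).
assert (Hx' : x <= psi - d - eta / 2) by (unfold x; lra).
assert (Hx3 : eta / 2 <= x) by (unfold x; lra).
assert (Hx2 : x <= PI / 2) by (unfold x; lra).
assert (Hc : 0 <= cos x) by (apply cos_ge_0; lra).
assert (Hc1 : cos x < 1).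
{ rewrite <- cos_0. apply cos_decreasing_1; lra. }
exists ((KR, a - eta) :: (KL, x - eta / 2) :: (KS, 2 * r * cos x) :: (KL, psi - d - x - eta / 2) :: l').
assert (0 <= tot l').
{ apply tot_nonneg; assumption. }
assert (0 <= 2 * r * cos x) by (apply Rmult_le_pos; lra).
assert (2 * r * cos x < 2 * r) by (rewrite <- (Rmult_1_r (2 * r)) at 2; apply Rmult_lt_compat_l; lra).
repeat split; simpl; try lra.
- valid_tac.
- intros th.
  change (disp th ((KR, a - eta) :: (KL, x - eta / 2) :: (KS, 2 * r * cos x) :: (KL, psi - d - x - eta / 2) :: l')
    = disp th ((KR, a) :: (KL, psi) :: l)).
  rewrite (disp_valley th a psi eta), !(disp_cons th), disp_LSL, HD.
  replace (x - eta / 2 + (psi - d - x - eta / 2)) with (psi - eta - d) by field.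
  replace (sin (eta / 2)) with (r / 4) by (symmetry; unfold eta; rewrite <- Hsa at 2; f_equal; field).
  unfold turn; simpl fst; simpl snd; cbv iota.
  assert (E := two_pow_cos (th - a + eta / 2) x r).
  replace (th - a + eta / 2 + 2 * x) with (th + - (a - eta) + (psi - eta) - d / 2) in E by (unfold x; field).
  replace (th - a + eta / 2 + x) with (th + - (a - eta) + (x - eta / 2)) in E by field.
  lra.
- simpl; unfold turn; simpl; lra.
- simpl; unfold turn; simpl; lra.
Qed.

Lemma disp_arc_plateau_L (th x r y : R) (l : list seg) :
  disp th ((KL, y) :: l) + r * cos (th + x) =
  disp th ((KL, x) :: (KS, r) :: (KL, y - x) :: l).
Proof. rewrite disp_LSL. replace (x + (y - x)) with y by ring. ring. Qed.

(* The final turn stops earlier, and the time saved there is spent at the same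
   headings during the preceding right turn, which passes them too. *)
Lemma improvable_three_arcs_low (e a psi chi : R) (l : list seg) :
  0 < a -> 0 < chi <= psi -> trimmable Rlt e l ->
  improvable e ((KL, a) :: (KR, psi) :: (KL, chi) :: l).
Proof.
intros Ha Hchi Ht.
destruct (Ht chi) as (d & r & c & l' & Hv & Hd & Hr & Hrc & HD & Htot & Hang); [lra|].
(* The right turn has the heading of the trimmed vector after [psi - (chi - d / 2)], which is
   nonnegative because [chi <= psi]. The gain is [c - r], so the trim has to be strict. *)
exists ((KL, a) :: (KR, psi - (chi - d / 2)) :: (KS, r) :: (KR, chi - d / 2) :: (KL, chi - d) :: l').
assert (0 <= tot l').
{ apply tot_nonneg; assumption. }
repeat split; try (simpl; lra).
- valid_tac.
- intros th. rewrite !(disp_cons th), disp_RSR.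
  rewrite (disp_cons _ (KR, psi)), HD.
  replace (psi - (chi - d / 2) + (chi - d / 2)) with psi by ring.
  rewrite disp_cons. unfold turn; simpl fst; simpl snd; cbv iota.
  replace (th + a - (psi - (chi - d / 2))) with (th + a + - psi + chi - d / 2) by ring.
  ring.
- simpl; unfold turn; simpl; lra.
- simpl; unfold turn; simpl; lra.
Qed.

Lemma disp_peak (th a y eta : R) (l : list seg) :
  disp th ((KL, a) :: (KR, y) :: l) =
  disp th ((KL, a - eta) :: (KR, y - eta) :: l) + 4 * sin (eta / 2) * cos (th + a - eta / 2).
Proof.
simpl. unfold disp1, turn; simpl.
replace (th + (a - eta) + - (y - eta)) with (th + a + - y) by ring.
assert (E := sin_minus_sin (th + a) (th + (a - eta))).
replace ((th + a - (th + (a - eta))) / 2) with (eta / 2) in E by field.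
replace ((th + a + (th + (a - eta))) / 2) with (th + a - eta / 2) in E by field.
replace (th + (a - eta) - (y - eta)) with (th + a - y) by ring.
lra.
Qed.

(* Here the last turn passes the headings near the first peak. *)
Lemma improvable_three_arcs_high (e a psi chi : R) (l : list seg) :
  0 <= e -> 0 < a -> 0 < psi <= chi -> valid l ->
  improvable e ((KL, a) :: (KR, psi) :: (KL, chi) :: l).
Proof.
intros He Ha Hchi Hv. assert (P2 := PI2_1).
set (d := Rmin (Rmin a psi) 1).
assert (Hd : 0 < d) by (unfold d; repeat apply Rmin_pos; lra).
assert (Hd1 : d <= 1) by apply Rmin_r.
assert (Hda : d <= a) by (eapply Rle_trans; [apply Rmin_l | apply Rmin_l]).
assert (Hdp : d <= psi) by (eapply Rle_trans; [apply Rmin_l | apply Rmin_r]).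
assert (Hs : 0 < sin (d / 2)) by (apply sin_gt_0; lra).
assert (Hs' : sin (d / 2) < d / 2) by (apply sin_lt_x; lra).
(* The peak loses a vector of heading [th + a - d / 2]; the last turn starts at [th + a - psi] and
   has that heading after [psi - d / 2]. *)
exists ((KL, a - d) :: (KR, psi - d) :: (KL, psi - d / 2) :: (KS, 4 * sin (d / 2)) :: (KL, chi - (psi - d / 2)) :: l).
assert (0 <= tot l).
{ apply tot_nonneg; assumption. }
repeat split; try (simpl; lra).
- valid_tac.
- intros th. rewrite (disp_peak th a psi d), !(disp_cons th), (disp_cons _ (KR, psi - d)).
  rewrite <- (disp_arc_plateau_L _ (psi - d / 2)).
  rewrite (disp_cons _ (KR, psi - d) ((KL, chi) :: l)).
  unfold turn; simpl fst; simpl snd; cbv iota.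
  replace (th + (a - d) + - (psi - d) + (psi - d / 2)) with (th + a - d / 2) by field.
  ring.
- simpl; unfold turn; simpl; lra.
- simpl; unfold turn; simpl; lra.
Qed.

(** Each lost vector is restored at its own heading, so the argument covers angles of any size. *)
Lemma improvable_three_arcs (e a psi chi : R) (l : list seg) :
  0 <= e -> 0 < a -> 0 < psi -> 0 < chi -> valid l -> trimmable Rlt e l ->
  improvable e ((KL, a) :: (KR, psi) :: (KL, chi) :: l).
Proof.
intros. destruct (Rle_dec chi psi).
- apply improvable_three_arcs_low; lra || assumption.
- apply improvable_three_arcs_high; lra || assumption.
Qed.

Lemma tot_pos (l : list seg) : Forall (fun s => 0 < snd s) l -> l <> [] -> 0 < tot l.
Proof.
intros H Hl. destruct H as [|s l Hs H]; [easy|]. simpl.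
enough (0 <= tot l) by lra. apply tot_nonneg. unfold valid.
eapply Forall_impl; [|exact H]. intros; simpl in *; lra.
Qed.

Lemma ang_app (l m : list seg) : ang (l ++ m) = ang l + ang m.
Proof. induction l as [|s l IH]; simpl; [ring|rewrite IH; ring]. Qed.

Lemma tot_app (l m : list seg) : tot (l ++ m) = tot l + tot m.
Proof. induction l as [|s l IH]; simpl; [ring|rewrite IH; ring]. Qed.

Lemma disp_app (th : R) (l m : list seg) :
  disp th (l ++ m) = disp th l + disp (th + ang l) m.
Proof.
revert th; induction l as [|s l IH]; intros th; simpl.
- rewrite Rplus_0_r; ring.
- rewrite IH, !Rplus_assoc. reflexivity.
Qed.

(** * Reflection and reversal *)

Definition flip (k : kind) : kind :=
  match k with KL => KR | KR => KL | KS => KS end.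

Definition mirror (l : list seg) : list seg :=
  map (fun s => (flip (fst s), snd s)) l.

Lemma disp_mirror (th : R) (l : list seg) : disp th (mirror l) = disp (- th) l.
Proof.
revert th; induction l as [|[[] x] l IH]; intros th; simpl; [reflexivity|..];
  rewrite IH; unfold disp1, turn; simpl; rewrite ?Ropp_plus_distr, ?Ropp_involutive, ?Ropp_0.
- f_equal. replace (- th + x) with (- (th - x)) by ring. rewrite !sin_neg. ring.
- f_equal. replace (- th - x) with (- (th + x)) by ring. rewrite !sin_neg. ring.
- rewrite cos_neg. reflexivity.
Qed.

Lemma ang_mirror (l : list seg) : ang (mirror l) = - ang l.
Proof.
induction l as [|[[] x] l IH]; simpl; [ring|..]; rewrite IH; unfold turn; simpl; ring.
Qed.

Lemma tot_mirror (l : list seg) : tot (mirror l) = tot l.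
Proof. induction l as [|s l IH]; simpl; congruence. Qed.

Lemma Forall_mirror (P : R -> Prop) (l : list seg) :
  Forall (fun s => P (snd s)) l -> Forall (fun s => P (snd s)) (mirror l).
Proof. intros H. induction H; constructor; assumption. Qed.

(* The heading function run backwards; as headings are not turned by [PI], the
   displacement is unchanged while left and right turns are exchanged. *)
Definition reversal (l : list seg) : list seg := rev (mirror l).

Lemma ang_rev (l : list seg) : ang (rev l) = ang l.
Proof. induction l as [|s l IH]; simpl; [reflexivity|]. rewrite ang_app, IH. simpl. ring. Qed.

Lemma tot_rev (l : list seg) : tot (rev l) = tot l.
Proof. induction l as [|s l IH]; simpl; [reflexivity|]. rewrite tot_app, IH. simpl. ring. Qed.

Lemma disp_reversal (th : R) (l : list seg) :
  disp (th + ang l) (reversal l) = disp th l.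
Proof.
unfold reversal. revert th; induction l as [|s l IH]; intros th; simpl; [reflexivity|].
fold (mirror l). rewrite disp_app. simpl.
replace (th + (turn s + ang l)) with (th + turn s + ang l) by ring.
rewrite IH, ang_rev, ang_mirror.
replace (th + turn s + ang l + - ang l) with (th + turn s) by ring.
destruct s as [[] x]; unfold disp1, turn; simpl.
- replace (th + x - x) with th by ring. ring.
- replace (th + - x + x) with th by ring. replace (th + - x) with (th - x) by ring. ring.
- rewrite !Rplus_0_r. ring.
Qed.

(** Stated for [e = 0] because a reflection turns a decrease of the final heading into an
    increase. *)
Lemma improvable_mirror (l : list seg) : improvable 0 (mirror l) -> improvable 0 l.
Proof.
intros (l' & Hv & Ht & HD & Ha). exists (mirror l').
rewrite tot_mirror, ang_mirror. rewrite tot_mirror, ang_mirror in *.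
repeat split; try lra.
- apply (Forall_mirror (fun x => 0 <= x)). assumption.
- intros th. rewrite disp_mirror, HD, disp_mirror. f_equal; ring.
Qed.

(** Stated for [e = 0] because reversal exchanges the two end headings, and the initial one is
    fixed. *)
Lemma improvable_reversal (l : list seg) : improvable 0 (reversal l) -> improvable 0 l.
Proof.
assert (Hang : forall l, ang (reversal l) = - ang l).
{ intros m. unfold reversal. rewrite ang_rev, ang_mirror. reflexivity. }
assert (Htot : forall l, tot (reversal l) = tot l).
{ intros m. unfold reversal. rewrite tot_rev, tot_mirror. reflexivity. }
intros (l' & Hv & Ht & HD & Ha). exists (reversal l').
rewrite Htot, Hang. rewrite Htot, Hang in *.
repeat split; try lra.
- apply Forall_rev. apply (Forall_mirror (fun x => 0 <= x)). assumption.
- intros th. assert (E : ang l' = - ang l) by lra.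
  replace th with ((th + ang l) + ang l') by (rewrite E; ring).
  rewrite disp_reversal, HD, disp_reversal. f_equal. rewrite E; ring.
Qed.

(** * Shortenings inside a word *)

Lemma trimmable_next (k : kind) (x : R) : 0 < x -> k <> KL -> trimmable Rle 0 [(k, x)].
Proof.
intros Hx Hk. destruct k; [easy|..].
- apply trimmable_weaken, trimmable_peak; lra.
- apply trimmable_line; lra.
Qed.

Lemma improvable_line_arc_then (c k : kind) (a psi x : R) :
  0 < a -> 0 < psi < 2 * PI -> 0 < x -> c <> KS -> k <> c ->
  improvable 0 [(KS, a); (c, psi); (k, x)].
Proof.
intros Ha Hpsi Hx Hc Hk. destruct c; [|apply improvable_mirror; simpl|easy].
- apply improvable_line; try assumption. apply trimmable_next; assumption.
- apply improvable_line; try assumption. apply trimmable_next; [assumption|].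
  destruct k; easy.
Qed.

Lemma improvable_before_arc_line (c k : kind) (a psi x : R) :
  0 < a -> 0 < psi < 2 * PI -> 0 < x -> c <> KS -> k <> c ->
  improvable 0 [(k, x); (c, psi); (KS, a)].
Proof.
intros. apply improvable_reversal. cbn.
apply improvable_line_arc_then; try assumption; destruct c, k; easy.
Qed.

Lemma improvable_short_middle_arc (c : kind) (a psi x : R) :
  0 < a -> 0 < psi <= PI -> 0 < x -> c <> KS ->
  improvable 0 [(c, a); (flip c, psi); (c, x)].
Proof.
intros. destruct c; [apply improvable_mirror| |easy]; simpl;
  apply improvable_arc_short; try assumption; apply trimmable_next; easy.
Qed.

(** The fourth arc forms a peak with the third, which supplies the strict trim. *)
Lemma improvable_four_arcs (c : kind) (a psi chi x : R) :
  0 < a -> 0 < psi -> 0 < chi -> 0 < x -> c <> KS ->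
  improvable 0 [(c, a); (flip c, psi); (c, chi); (flip c, x)].
Proof.
intros. destruct c; [|apply improvable_mirror|easy]; simpl;
  (apply improvable_three_arcs; try assumption;
    [lra | valid_tac | apply trimmable_peak; lra]).
Qed.

(** * Optimal words *)

Definition optimal (ok : R -> Prop) (l : list seg) : Prop :=
  ok (ang l) /\
  forall l', valid l' -> 0 < tot l' -> (forall th, disp th l' = disp th l) ->
    ok (ang l') -> tot l <= tot l'.

Lemma optimal_mirror (ok : R -> Prop) (l : list seg) :
  optimal ok l -> optimal (fun x => ok (- x)) (mirror l).
Proof.
intros [Hok H]. split.
- rewrite ang_mirror, Ropp_involutive. assumption.
- intros l' Hv Ht HD Ha. rewrite tot_mirror, <- (tot_mirror l'). apply H.
  + apply (Forall_mirror (fun x => 0 <= x)). assumption.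
  + rewrite tot_mirror; assumption.
  + intros th. rewrite disp_mirror, HD, disp_mirror. f_equal; ring.
  + rewrite ang_mirror. assumption.
Qed.

Definition all_pos (l : list seg) : Prop := Forall (fun s => 0 < snd s) l.

Lemma all_pos_valid (l : list seg) : all_pos l -> valid l.
Proof. apply Forall_impl. intros; lra. Qed.

(** Nothing follows a suffix, so its final heading may move as far as [ok] tolerates. *)
Lemma optimal_suffix (ok : R -> Prop) (e : R) (l pre suf : list seg) :
  optimal ok l -> all_pos l -> l = pre ++ suf ->
  (forall x, ang l - e <= x <= ang l -> ok x) -> ~ improvable e suf.
Proof.
intros [_ H] Hp -> Hok (l' & Hv & Ht & HD & Ha).
apply Forall_app in Hp as [Hp1 Hp2].
assert (Hpre := tot_nonneg pre (all_pos_valid pre Hp1)).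
specialize (H (pre ++ l')). rewrite !tot_app in H.
enough (tot pre + tot suf <= tot pre + tot l') by lra.
apply H; try lra.
- apply Forall_app; split; [apply all_pos_valid|]; assumption.
- intros th. rewrite !disp_app, HD. reflexivity.
- apply Hok. rewrite !ang_app. lra.
Qed.

(** An infix has to keep its turn, or else [post] would be rotated; hence [improvable 0]. *)
Lemma optimal_infix (ok : R -> Prop) (l pre mid post : list seg) :
  optimal ok l -> all_pos l -> l = pre ++ mid ++ post -> ~ improvable 0 mid.
Proof.
intros Hopt Hp E (l' & Hv & Ht & HD & Ha).
refine (optimal_suffix ok 0 l pre (mid ++ post) Hopt Hp E _ _).
- intros x Hx. replace x with (ang l) by lra. apply Hopt.
- rewrite E in Hp. apply Forall_app in Hp as [_ Hp]. apply Forall_app in Hp as [_ Hp].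
  exists (l' ++ post). assert (Hpost := tot_nonneg post (all_pos_valid post Hp)).
  rewrite !tot_app, !ang_app. assert (Ea : ang l' = ang mid) by lra.
  repeat split; try lra.
  + apply Forall_app; split; [|apply all_pos_valid]; assumption.
  + intros th. rewrite !disp_app, HD, Ea. reflexivity.
Qed.

Lemma disp_2PI (th : R) (n : nat) (l : list seg) :
  disp (th + 2 * INR n * PI) l = disp th l.
Proof.
revert th; induction l as [|[[] x] l IH]; intros th; simpl; [reflexivity|..];
  unfold disp1, turn; simpl.
- replace (th + 2 * INR n * PI + x) with (th + x + 2 * INR n * PI) by ring.
  rewrite IH, !sin_period. reflexivity.
- replace (th + 2 * INR n * PI + - x) with (th + - x + 2 * INR n * PI) by ring.
  replace (th + 2 * INR n * PI - x) with (th - x + 2 * INR n * PI) by ring.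
  rewrite IH, !sin_period. reflexivity.
- rewrite !Rplus_0_r, IH, cos_period. reflexivity.
Qed.

Lemma optimal_arc_lt_2PI (ok : R -> Prop) (pre post : list seg) (c : kind) (x : R) :
  (forall y, ok (y + 2 * PI) <-> ok y) ->
  optimal ok (pre ++ (c, x) :: post) -> all_pos (pre ++ (c, x) :: post) ->
  pre ++ post <> [] -> c <> KS -> x < 2 * PI.
Proof.
intros Hper [Hok H] Hp Hne Hc. apply Rnot_le_lt. intros Hx. assert (HPI := PI_RGT_0).
apply Forall_app in Hp as [Hp1 Hp2]. apply Forall_cons_iff in Hp2 as [Hx0 Hp2].
assert (Hp : all_pos (pre ++ post)) by (apply Forall_app; split; assumption).
apply tot_pos in Hp; [|assumption]. rewrite tot_app in Hp.
specialize (H (pre ++ (c, x - 2 * PI) :: post)). rewrite !tot_app in H. simpl in H.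
enough (tot pre + (x + tot post) <= tot pre + (x - 2 * PI + tot post)) by lra.
apply H.
- apply Forall_app; split; [apply all_pos_valid; assumption|].
  constructor; [simpl; lra | apply all_pos_valid; assumption].
- lra.
- intros th. rewrite !disp_app. f_equal. simpl. set (t := th + ang pre).
  destruct c; [..|easy]; unfold disp1, turn; simpl.
  + rewrite <- (disp_2PI (t + (x - 2 * PI)) 1), <- (sin_period (t + (x - 2 * PI)) 1).
    simpl INR. replace (t + (x - 2 * PI) + 2 * 1 * PI) with (t + x) by ring. reflexivity.
  + rewrite <- (disp_2PI (t + - x) 1), <- (sin_period (t - x) 1).
    simpl INR. replace (t + - x + 2 * 1 * PI) with (t + - (x - 2 * PI)) by ring.
    replace (t - x + 2 * 1 * PI) with (t - (x - 2 * PI)) by ring. reflexivity.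
- rewrite ang_app in Hok |- *. simpl in Hok |- *.
  destruct c; [..|easy]; unfold turn in *; simpl in *.
  + apply Hper. replace (ang pre + (x - 2 * PI + ang post) + 2 * PI) with (ang pre + (x + ang post)) by ring. assumption.
  + replace (ang pre + (- (x - 2 * PI) + ang post)) with (ang pre + (- x + ang post) + 2 * PI) by ring. apply Hper. assumption.
Qed.

Fixpoint distinct (l : list seg) : Prop :=
  match l with
  | s :: (t :: _) as l' => fst s <> fst t /\ distinct l'
  | _ => True
  end.

(** Among four segments, a line anywhere is adjacent to an arc in second or third position, and the
    three segments around that arc can be improved. Without lines the four arcs alternate. *)
Lemma optimal_length (ok : R -> Prop) (l : list seg) :
  (forall y, ok (y + 2 * PI) <-> ok y) ->
  optimal ok l -> all_pos l -> distinct l -> (length l <= 3)%nat.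
Proof.
intros Hper Hopt Hp Hd.
destruct l as [|[k1 x1] [|[k2 x2] [|[k3 x3] [|[k4 x4] l]]]]; simpl; try lia.
exfalso. simpl in Hd. destruct Hd as (H12 & H23 & H34 & _).
assert (L2 := optimal_arc_lt_2PI ok [(k1, x1)] ((k3, x3) :: (k4, x4) :: l) k2 x2 Hper Hopt Hp ltac:(easy)).
assert (L3 := optimal_arc_lt_2PI ok [(k1, x1); (k2, x2)] ((k4, x4) :: l) k3 x3 Hper Hopt Hp ltac:(easy)).
assert (I1 := optimal_infix ok _ [] [_; _; _] ((k4, x4) :: l) Hopt Hp eq_refl).
assert (I2 := optimal_infix ok _ [(k1, x1)] [_; _; _] l Hopt Hp eq_refl).
assert (I3 := optimal_infix ok _ [] [_; _; _; _] l Hopt Hp eq_refl).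
assert (0 < x1 /\ 0 < x2 /\ 0 < x3 /\ 0 < x4) as (P1 & P2 & P3 & P4).
{ inversion Hp; inversion H2; inversion H6; inversion H10; subst; simpl in *; auto. }
assert (Hb : forall k x, (k <> KS -> x < 2 * PI) -> 0 < x -> k <> KS -> 0 < x < 2 * PI) by auto.
destruct k1, k2, k3, k4; try congruence;
  solve [ apply I1; apply improvable_line_arc_then; eauto; easy
        | apply I2; apply improvable_line_arc_then; eauto; easy
        | apply I1; apply improvable_before_arc_line; eauto; easy
        | apply I2; apply improvable_before_arc_line; eauto; easy
        | apply I3; apply (improvable_four_arcs KL); easy
        | apply I3; apply (improvable_four_arcs KR); easy ].
Qed.

(** * Shapes of optimal words *)

Definition seg_matches (s : seg) (a : letter) : Prop :=
  match fst s, a with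
  | KL, arcL c => c (snd s)
  | KR, arcR c => c (snd s)
  | KS, lineS => True
  | _, _ => False
  end.

Definition has_type (l : list seg) (w : list letter) : Prop :=
  exists w', subword w' w /\ Forall2 seg_matches l w'.

Definition free_shape (l : list seg) : Prop :=
  has_type l [Lt; St] \/ has_type l [Rt; St] \/
  has_type l [Lt; Rt_gtPI] \/ has_type l [Rt; Lt_gtPI].

(** Besides [free_shape], these remain when the final heading can decrease but perhaps not increase,
    as at [theta_max]; [ascending_shape] is the mirror image. *)
Definition descending_shape (l : list seg) : Prop :=
  has_type l [Lt; St; Rt] \/ has_type l [Rt; St; Rt] \/ has_type l [Rt; Lt_gtPI; Rt].

Definition ascending_shape (l : list seg) : Prop :=
  has_type l [Rt; St; Lt] \/ has_type l [Lt; St; Lt] \/ has_type l [Lt; Rt_gtPI; Lt].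

Lemma has_type_nil (w : list letter) : has_type [] w.
Proof.
exists []. split; [induction w; constructor; assumption | constructor].
Qed.

Lemma has_type_keep (s : seg) (l : list seg) (a : letter) (w : list letter) :
  seg_matches s a -> has_type l w -> has_type (s :: l) (a :: w).
Proof.
intros Hs (w' & Hw & H). exists (a :: w'). split; constructor; assumption.
Qed.

Lemma has_type_delete (l : list seg) (a : letter) (w : list letter) :
  has_type l w -> has_type l (a :: w).
Proof.
intros (w' & Hw & H). exists w'. split; [constructor|]; assumption.
Qed.

Ltac matches_tac := simpl; first [exact I | assumption].

Ltac has_type_tac :=
  first [ apply has_type_nil
        | apply has_type_keep; [solve [matches_tac] | has_type_tac]
        | apply has_type_delete; has_type_tac ].

(** A middle arc with a line on either side can be improved, so its neighbours are arcs of the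
    opposite direction, and then a turn up to [PI] is improvable. *)
Lemma optimal_middle (ok : R -> Prop) (k1 k2 k3 : kind) (x1 x2 x3 : R) :
  (forall y, ok (y + 2 * PI) <-> ok y) ->
  optimal ok [(k1, x1); (k2, x2); (k3, x3)] ->
  all_pos [(k1, x1); (k2, x2); (k3, x3)] -> distinct [(k1, x1); (k2, x2); (k3, x3)] ->
  k2 = KS \/ (k1 = k3 /\ k2 = flip k1 /\ k1 <> KS /\ PI < x2).
Proof.
intros Hper Hopt Hp (H12 & H23 & _). simpl in H12, H23.
assert (I1 := optimal_infix ok _ [] [_; _; _] [] Hopt Hp eq_refl).
assert (L2 := optimal_arc_lt_2PI ok [(k1, x1)] [(k3, x3)] k2 x2 Hper Hopt Hp ltac:(easy)).
assert (0 < x1 /\ 0 < x2 /\ 0 < x3) as (P1 & P2 & P3).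
{ inversion Hp; inversion H2; inversion H6; subst; simpl in *; auto. }
destruct (Rlt_dec PI x2) as [Hx|Hx].
- destruct k1, k2, k3; try congruence; try (now left); try (right; easy); exfalso; apply I1;
  first [ apply improvable_line_arc_then; solve [assumption | easy | split; [assumption | apply L2; easy]]
        | apply improvable_before_arc_line; solve [assumption | easy | split; [assumption | apply L2; easy]]].
- apply Rnot_lt_le in Hx. assert (HPI := PI_RGT_0).
  destruct k1, k2, k3; try congruence; try (now left); exfalso; apply I1;
  first [ apply improvable_line_arc_then; solve [assumption | easy | lra]
        | apply improvable_before_arc_line; solve [assumption | easy | lra]
        | apply (improvable_short_middle_arc KL); solve [assumption | easy | lra]
        | apply (improvable_short_middle_arc KR); solve [assumption | easy | lra]].
Qed.

Definition can_descend (ok : R -> Prop) (l : list seg) : Prop :=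
  exists e, 0 < e /\ forall x, ang l - e <= x <= ang l -> ok x.

Definition can_ascend (ok : R -> Prop) (l : list seg) : Prop :=
  exists e, 0 < e /\ forall x, ang l <= x <= ang l + e -> ok x.

Lemma can_ascend_mirror (ok : R -> Prop) (l : list seg) :
  can_ascend ok l -> can_descend (fun x => ok (- x)) (mirror l).
Proof.
intros (e & He & H). exists e. split; [assumption|]. intros x Hx.
rewrite ang_mirror in Hx. apply H. lra.
Qed.

(** What trimming a final left turn at the end of the path leaves; applied to [mirror l], what
    trimming a final right turn leaves. *)
Definition descending_end (l : list seg) : Prop :=
  (forall pre a psi, l <> pre ++ [(KS, a); (KL, psi)]) /\
  (forall pre a psi, l = pre ++ [(KR, a); (KL, psi)] -> PI < psi) /\
  (forall pre a psi chi, l <> pre ++ [(KL, a); (KR, psi); (KL, chi)]).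

Lemma optimal_descending_end (ok : R -> Prop) (l : list seg) :
  (forall y, ok (y + 2 * PI) <-> ok y) ->
  optimal ok l -> all_pos l -> can_descend ok l -> descending_end l.
Proof.
intros Hper Hopt Hp (e & He & Hok).
assert (Hpos : forall pre post, l = pre ++ post -> all_pos post).
{ intros pre post E. rewrite E in Hp. apply Forall_app in Hp. tauto. }
repeat split.
- intros pre a psi E. assert (Hq := Hpos _ _ E).
  inversion Hq as [|? ? Ha Hq']; inversion Hq' as [|? ? Hpsi _]; simpl in *; subst.
  apply (optimal_suffix ok e _ pre _ Hopt Hp eq_refl Hok).
  apply improvable_line; [assumption| |apply trimmable_weaken, trimmable_end; assumption].
  split; [assumption|].
  apply (optimal_arc_lt_2PI ok (pre ++ [(KS, a)]) [] KL psi Hper); rewrite <- ?app_assoc; simpl; try assumption; try easy.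
  destruct pre; easy.
- intros pre a psi E. assert (Hq := Hpos _ _ E).
  inversion Hq as [|? ? Ha Hq']; inversion Hq' as [|? ? Hpsi _]; simpl in *; subst.
  apply Rnot_le_lt. intros Hle.
  apply (optimal_suffix ok e _ pre _ Hopt Hp eq_refl Hok).
  apply improvable_arc_short; [assumption|lra|apply trimmable_weaken, trimmable_end; assumption].
- intros pre a psi chi E. assert (Hq := Hpos _ _ E).
  inversion Hq as [|? ? Ha Hq']; inversion Hq' as [|? ? Hpsi Hq'']; inversion Hq'' as [|? ? Hchi _]; simpl in *; subst.
  apply (optimal_suffix ok e _ pre _ Hopt Hp eq_refl Hok).
  apply improvable_three_arcs; try assumption; [lra | valid_tac | apply trimmable_end; assumption].
Qed.

Lemma short_list (l : list seg) :
  (length l <= 3)%nat -> l <> [] ->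
  (exists s, l = [s]) \/ (exists s t, l = [s; t]) \/ (exists s t u, l = [s; t; u]).
Proof.
destruct l as [|s [|t [|u [|v l]]]]; simpl; intros Hl Hne; try easy; try lia; eauto 6.
Qed.

(** For the last claim: three segments would have to end in a right turn by the first restriction
    and in a left turn by the second, so at most two segments are left. *)
Lemma optimal_shape (ok : R -> Prop) (l : list seg) :
  (forall y, ok (y + 2 * PI) <-> ok y) ->
  optimal ok l -> all_pos l -> distinct l -> l <> [] ->
  (descending_end l -> free_shape l \/ descending_shape l) /\
  (descending_end (mirror l) -> free_shape l \/ ascending_shape l) /\
  (descending_end l -> descending_end (mirror l) -> free_shape l).
Proof.
intros Hper Hopt Hp Hd Hne.
assert (Hl := optimal_length ok l Hper Hopt Hp Hd).
destruct (short_list l Hl Hne) as [[[k1 x1] ->]|[([k1 x1] & [k2 x2] & ->)|([k1 x1] & [k2 x2] & [k3 x3] & ->)]].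
- enough (free_shape [(k1, x1)]) by tauto. unfold free_shape.
  destruct k1; [left|right; left|left]; has_type_tac.
- destruct Hd as [Hd _]; simpl in Hd.
  assert (D1 : descending_end [(k1, x1); (k2, x2)] ->
    ~ (k1 = KS /\ k2 = KL) /\ (k1 = KR -> k2 = KL -> PI < x2)).
  { intros (E1 & E2 & _). split.
    - intros [-> ->]. exact (E1 [] _ _ eq_refl).
    - intros -> ->. exact (E2 [] _ _ eq_refl). }
  assert (D2 : descending_end (mirror [(k1, x1); (k2, x2)]) ->
    ~ (k1 = KS /\ k2 = KR) /\ (k1 = KL -> k2 = KR -> PI < x2)).
  { intros (E1 & E2 & _). split.
    - intros [-> ->]. exact (E1 [] _ _ eq_refl).
    - intros -> ->. exact (E2 [] _ _ eq_refl). }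
  (* The four exceptions split evenly: [SR] and a short [LR] are degenerate forms of [LSR], while
     [SL] and a short [RL] are degenerate forms of [RSL]. *)
  assert (Q : free_shape [(k1, x1); (k2, x2)] \/
    (k1 = KS /\ k2 = KL) \/ (k1 = KS /\ k2 = KR) \/
    (k1 = KL /\ k2 = KR /\ ~ PI < x2) \/ (k1 = KR /\ k2 = KL /\ ~ PI < x2)).
  { destruct (Rlt_dec PI x2); destruct k1, k2; try congruence; try tauto;
    left; unfold free_shape;
    first [left; has_type_tac | right; left; has_type_tac
      | right; right; left; has_type_tac | right; right; right; has_type_tac]. }
  repeat split.
  + intros E. destruct (D1 E) as [E1 E2].
    destruct Q as [Q|[Q|[[-> ->]|[(-> & -> & Q)|(-> & -> & Q)]]]]; try tauto;
      right; left; has_type_tac.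
  + intros E. destruct (D2 E) as [E1 E2].
    destruct Q as [Q|[[-> ->]|[Q|[(-> & -> & Q)|(-> & -> & Q)]]]]; try tauto;
      right; left; has_type_tac.
  + intros E E'. destruct (D1 E) as [E1 E2]. destruct (D2 E') as [E3 E4]. tauto.
- assert (M := optimal_middle ok _ _ _ _ _ _ Hper Hopt Hp Hd).
  destruct Hd as (H12 & H23 & _). simpl in H12, H23.
  set (l := [(k1, x1); (k2, x2); (k3, x3)]).
  (* By [M], a final left turn would give the ending [SL] or the word [LRL], and a final line is
     impossible. *)
  assert (D1 : descending_end l -> k3 = KR).
  { intros (E1 & E2 & E3). destruct k3; [exfalso|reflexivity|exfalso].
    - destruct M as [->|(-> & -> & _ & _)].
      + exact (E1 [(k1, x1)] _ _ eq_refl).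
      + exact (E3 [] _ _ _ eq_refl).
    - destruct M as [M|(-> & _ & M & _)]; congruence. }
  assert (D2 : descending_end (mirror l) -> k3 = KL).
  { intros (E1 & E2 & E3). destruct k3; [reflexivity|exfalso..].
    - destruct M as [->|(-> & -> & _ & _)].
      + exact (E1 [(flip k1, x1)] _ _ eq_refl).
      + exact (E3 [] _ _ _ eq_refl).
    - destruct M as [M|(-> & _ & M & _)]; congruence. }
  repeat split.
  + intros E. right. unfold l, descending_shape. rewrite (D1 E) in M |- *.
    destruct M as [->|(-> & -> & _ & Hx)].
    * destruct k1; [left; has_type_tac|right; left; has_type_tac|congruence].
    * right; right; has_type_tac.
  + intros E. right. unfold l, ascending_shape. rewrite (D2 E) in M |- *.
    destruct M as [->|(-> & -> & _ & Hx)].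
    * destruct k1; [right; left; has_type_tac|left; has_type_tac|congruence].
    * right; right; has_type_tac.
  + intros E E'. rewrite (D1 E) in D2. discriminate (D2 E').
Qed.

From Coquelicot Require Import Coquelicot.

(** * Integrals and one-sided derivatives *)

(** Continuity on the whole line makes every integral exist without a condition on its bounds. *)
Definition cts (f : R -> R) : Prop := forall t, continuous f t.

Lemma cts_const (c : R) : cts (fun _ => c).
Proof. intros t. apply continuous_const. Qed.

Lemma cts_id : cts (fun t => t).
Proof. intros t. apply continuous_id. Qed.

Lemma cts_plus (f g : R -> R) : cts f -> cts g -> cts (fun t => f t + g t).
Proof. intros Hf Hg t. apply (continuous_plus f g); [apply Hf | apply Hg]. Qed.

Lemma cts_opp (f : R -> R) : cts f -> cts (fun t => - f t).
Proof. intros Hf t. apply (continuous_opp f), Hf. Qed.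

Lemma cts_minus (f g : R -> R) : cts f -> cts g -> cts (fun t => f t - g t).
Proof. intros Hf Hg t. apply (continuous_minus f g); [apply Hf | apply Hg]. Qed.

Lemma cts_mult (f g : R -> R) : cts f -> cts g -> cts (fun t => f t * g t).
Proof. intros Hf Hg t. apply (continuous_mult f g); [apply Hf | apply Hg]. Qed.

Lemma cts_comp (f g : R -> R) : cts f -> cts g -> cts (fun t => g (f t)).
Proof. intros Hf Hg t. apply (continuous_comp f g); [apply Hf | apply Hg]. Qed.

Lemma cts_cos (f : R -> R) : cts f -> cts (fun t => cos (f t)).
Proof. intros Hf. apply (cts_comp f cos Hf). intros t. apply continuous_cos. Qed.

Lemma cts_sin (f : R -> R) : cts f -> cts (fun t => sin (f t)).
Proof. intros Hf. apply (cts_comp f sin Hf). intros t. apply continuous_sin. Qed.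

Lemma cts_derive (f df : R -> R) : (forall t, is_derive f t (df t)) -> cts f.
Proof. intros H t. apply (ex_derive_continuous f). eexists; apply H. Qed.

Lemma cts_continuity_pt (f : R -> R) : cts f -> forall t, continuity_pt f t.
Proof. intros Hf t. apply continuity_pt_filterlim, Hf. Qed.

Lemma cts_lipschitz (f : R -> R) :
  (forall x y, Rabs (f x - f y) <= Rabs (x - y)) -> cts f.
Proof.
intros H t. apply continuity_pt_filterlim. intros eps Heps. exists eps.
split; [assumption|]. intros x [_ Hx]. simpl in *. unfold R_dist in *.
eapply Rle_lt_trans; [apply H | assumption].
Qed.

Lemma cts_Rmin (c : R) : cts (fun t => Rmin t c).
Proof.
apply cts_lipschitz. intros x y. unfold Rmin, Rabs.
repeat destruct Rle_dec; repeat destruct Rcase_abs; lra.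
Qed.

Lemma cts_Rmax (c : R) : cts (fun t => Rmax t c).
Proof.
apply cts_lipschitz. intros x y. unfold Rmax, Rabs.
repeat destruct Rle_dec; repeat destruct Rcase_abs; lra.
Qed.

Ltac cts_tac :=
  try assumption;
  lazymatch goal with
  | |- cts (fun t => t) => apply cts_id
  | |- cts (fun t => cos _) => apply cts_cos; cts_tac
  | |- cts (fun t => sin _) => apply cts_sin; cts_tac
  | |- cts (fun t => _ - _) => apply cts_minus; cts_tac
  | |- cts (fun t => _ + _) => apply cts_plus; cts_tac
  | |- cts (fun t => _ * _) => apply cts_mult; cts_tac
  | |- cts (fun t => - _) => apply cts_opp; cts_tac
  | |- cts (fun t => ?c) => apply cts_const
  | _ => idtac
  end.

Lemma ex_RInt_cts (f : R -> R) (a b : R) : cts f -> ex_RInt f a b.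
Proof. intros Hf. apply (ex_RInt_continuous f). intros t _. apply Hf. Qed.

Definition integral (f : R -> R) (a b : R) : R := RInt f a b.

Lemma integral_ext (f g : R -> R) (a b : R) :
  (forall t, Rmin a b < t < Rmax a b -> f t = g t) -> integral f a b = integral g a b.
Proof. apply RInt_ext. Qed.

Lemma integral_point (a : R) (f : R -> R) : integral f a a = 0.
Proof. apply (RInt_point a f). Qed.

Lemma is_derive_integral (f : R -> R) (a c t : R) :
  cts f -> is_derive (fun t => c + integral f a t) t (f t).
Proof.
intros Hf. rewrite <- (Rplus_0_l (f t)).
apply (is_derive_plus (fun _ => c) (fun t => RInt f a t)).
- apply (is_derive_const (V := R_NormedModule)).
- apply (is_derive_RInt f (fun t => RInt f a t) a).
  + apply filter_forall. intros x. apply (RInt_correct f), ex_RInt_cts, Hf.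
  + apply Hf.
Qed.

Lemma integral_of_derive (f df : R -> R) (a b : R) :
  (forall t, is_derive f t (df t)) -> cts df -> integral df a b = f b - f a.
Proof.
intros Hf Hdf. apply (is_RInt_unique df).
apply (is_RInt_derive f df); intros t _; [apply Hf | apply Hdf].
Qed.

Lemma integral_add (f g : R -> R) (a b : R) : cts f -> cts g ->
  integral (fun t => f t + g t) a b = integral f a b + integral g a b.
Proof. intros Hf Hg. apply (RInt_plus f g); apply ex_RInt_cts; assumption. Qed.

Lemma integral_mulc (c : R) (f : R -> R) (a b : R) : cts f ->
  integral (fun t => c * f t) a b = c * integral f a b.
Proof. intros Hf. apply (RInt_scal f a b c). apply ex_RInt_cts; assumption. Qed.

Lemma integral_join (f : R -> R) (a b c : R) : cts f ->
  integral f a b + integral f b c = integral f a c.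
Proof. intros Hf. apply (RInt_Chasles f); apply ex_RInt_cts; assumption. Qed.

Lemma integral_const_R (c a b : R) : integral (fun _ => c) a b = c * (b - a).
Proof.
unfold integral. rewrite (RInt_const (V := R_CompleteNormedModule) a b c). apply Rmult_comm.
Qed.

Lemma integral_shift (f : R -> R) (c a b : R) : cts f ->
  integral (fun t => f (t - c)) (a + c) (b + c) = integral f a b.
Proof.
intros Hf. set (F := fun t => 0 + integral f a t).
assert (HF : forall t, is_derive F t (f t)) by (intros t; apply is_derive_integral, Hf).
rewrite (integral_of_derive F f a b HF Hf).
rewrite (integral_of_derive (fun t => F (t - c)) (fun t => f (t - c))).
- f_equal; f_equal; ring.
- intros t. rewrite <- (Rmult_1_l (f (t - c))).
  apply (is_derive_comp F (fun t => t - c)); [apply HF|].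
  auto_derive; [exact I | ring].
- apply (cts_comp (fun t => t - c) f); cts_tac.
Qed.

Lemma integral_nonneg (f : R -> R) (a b : R) : a <= b -> cts f ->
  (forall t, a <= t <= b -> 0 <= f t) -> 0 <= integral f a b.
Proof.
intros Hab Hf H. apply RInt_ge_0; [assumption | apply ex_RInt_cts; assumption |].
intros t Ht. apply H. lra.
Qed.

Lemma cts_pos_near (f : R -> R) (t : R) : cts f -> 0 < f t ->
  exists d, 0 < d /\ forall x, Rabs (x - t) < d -> 0 < f x.
Proof.
intros Hf Ht. destruct (cts_continuity_pt f Hf t (f t) Ht) as (d & Hd & H).
exists d. split; [assumption|]. intros x Hx.
destruct (Req_dec x t) as [->|Hne]; [assumption|].
assert (E : Rabs (f x - f t) < f t).
{ apply H. split; [split; [exact I | congruence] | assumption]. }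
apply Rabs_def2 in E. lra.
Qed.

Lemma integral_pos (f : R -> R) (a b c : R) : a < b -> cts f ->
  (forall t, a <= t <= b -> 0 <= f t) -> a <= c <= b -> 0 < f c -> 0 < integral f a b.
Proof.
intros Hab Hf H Hc Hfc. destruct (cts_pos_near f c Hf Hfc) as (d & Hd & Hnear).
set (a' := Rmax a (c - d / 2)). set (b' := Rmin b (c + d / 2)).
assert (Ha : a <= a' /\ c - d / 2 <= a') by (unfold a'; split; [apply Rmax_l | apply Rmax_r]).
assert (Hb : b' <= b /\ b' <= c + d / 2) by (unfold b'; split; [apply Rmin_l | apply Rmin_r]).
assert (Hab' : a' < b') by (unfold a', b', Rmax, Rmin; repeat destruct Rle_dec; lra).
rewrite <- (integral_join f a a' b), <- (integral_join f a' b' b) by assumption.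
assert (0 <= integral f a a') by (apply integral_nonneg; [lra | assumption |]; intros; apply H; lra).
assert (0 <= integral f b' b) by (apply integral_nonneg; [lra | assumption |]; intros; apply H; lra).
enough (0 < integral f a' b') by lra.
apply RInt_gt_0; [assumption | | intros; apply Hf].
intros t Ht. apply Hnear. apply Rabs_def1; lra.
Qed.

Lemma constant_of_derive (f : R -> R) (a b : R) : cts f ->
  (forall t, a < t < b -> is_derive f t 0) ->
  forall t, a <= t <= b -> f t = f a.
Proof.
intros Hf Hd t Ht. destruct (Req_dec t a) as [->|Hta]; [reflexivity|].
destruct (MVT_gen f a t (fun _ => 0)) as (c & _ & E).
- rewrite Rmin_left, Rmax_right by lra. intros x Hx. apply Hd. lra.
- intros x _. apply cts_continuity_pt, Hf.
- lra.
Qed.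

(** Composition with [clamp a b] extends a function from [[a, b]] by its end values and turns
    one-sided continuity at the ends into [cts]. *)
Definition clamp (a b t : R) : R := Rmax (Rmin t b) a.

Lemma clamp_in (a b t : R) : a <= b -> a <= clamp a b t <= b.
Proof. intros. unfold clamp, Rmax, Rmin. repeat destruct Rle_dec; lra. Qed.

Lemma clamp_id (a b t : R) : a <= t <= b -> clamp a b t = t.
Proof. intros. unfold clamp, Rmax, Rmin. repeat destruct Rle_dec; lra. Qed.

Lemma clamp_lipschitz (a b x y : R) : Rabs (clamp a b x - clamp a b y) <= Rabs (x - y).
Proof.
unfold clamp, Rmax, Rmin, Rabs.
repeat destruct Rle_dec; repeat destruct Rcase_abs; lra.
Qed.

Lemma cts_clamp (a b : R) (f : R -> R) : a <= b -> cont_on a b f ->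
  cts (fun t => f (clamp a b t)).
Proof.
intros Hab Hf t. apply continuity_pt_filterlim. intros eps Heps.
destruct (Hf (clamp a b t) (clamp_in a b t Hab) eps Heps) as (d & Hd & H).
exists d. split; [assumption|]. intros x [_ Hx]. simpl in *. unfold R_dist in *.
destruct (Req_dec (clamp a b x) (clamp a b t)) as [->|Hne].
- unfold Rminus. rewrite Rplus_opp_r, Rabs_R0. assumption.
- apply H. split; [split; [apply clamp_in; assumption | congruence]|].
  eapply Rle_lt_trans; [apply clamp_lipschitz | assumption].
Qed.

Lemma D_in_restrict (f d : R -> R) (D D' : R -> Prop) (t : R) :
  (forall x, D' x -> D x) -> D_in f d D t -> D_in f d D' t.
Proof.
intros HD. unfold D_in. apply limit1_imp. intros x [Hx Hne]. split; auto.
Qed.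

(** Since [a < b], points of the interval accumulate at [t] from some side, which determines even a
    one-sided derivative. *)
Lemma D_in_unique (f d e : R -> R) (a b t : R) : a < b -> a <= t <= b ->
  D_in f d (fun s => a <= s <= b) t -> D_in f e (fun s => a <= s <= b) t -> d t = e t.
Proof.
intros Hab Ht Hd He. destruct (Req_dec (d t) (e t)) as [|Hne]; [assumption|exfalso].
set (eps := Rabs (d t - e t) / 2).
assert (Heps : 0 < eps).
{ unfold eps. assert (0 < Rabs (d t - e t)) by (apply Rabs_pos_lt; lra). lra. }
destruct (Hd eps Heps) as (d1 & Hd1 & H1). destruct (He eps Heps) as (d2 & Hd2 & H2).
assert (exists x, a <= x <= b /\ x <> t /\ Rabs (x - t) < d1 /\ Rabs (x - t) < d2)
  as (x & Hx & Hxt & Hx1 & Hx2).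
{ set (h := Rmin (Rmin d1 d2) (b - a) / 2).
  assert (0 < Rmin (Rmin d1 d2) (b - a)) by (repeat apply Rmin_pos; lra).
  assert (Hh : Rmin (Rmin d1 d2) (b - a) <= b - a) by apply Rmin_r.
  assert (Hh1 : Rmin (Rmin d1 d2) (b - a) <= d1) by (eapply Rle_trans; apply Rmin_l).
  assert (Hh2 : Rmin (Rmin d1 d2) (b - a) <= d2) by (eapply Rle_trans; [apply Rmin_l | apply Rmin_r]).
  destruct (Rle_dec t ((a + b) / 2)).
  - exists (t + h). unfold h. repeat split; try lra; apply Rabs_def1; lra.
  - exists (t - h). unfold h. repeat split; try lra; apply Rabs_def1; lra. }
assert (K1 := H1 x (conj (conj Hx (not_eq_sym Hxt)) Hx1)).
assert (K2 := H2 x (conj (conj Hx (not_eq_sym Hxt)) Hx2)).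
simpl in K1, K2. unfold R_dist in K1, K2.
set (q := (f x - f t) / (x - t)) in *.
assert (Rabs (d t - e t) <= Rabs (q - e t) + Rabs (q - d t)).
{ replace (d t - e t) with ((q - e t) - (q - d t)) by ring.
  eapply Rle_trans; [apply Rabs_triang|]. rewrite Rabs_Ropp. lra. }
unfold eps in *. lra.
Qed.

Lemma D_in_is_derive (f d : R -> R) (a b t : R) : a < t < b ->
  D_in f d (fun s => a <= s <= b) t -> is_derive f t (d t).
Proof.
intros Ht Hd. apply is_derive_Reals. intros eps Heps.
destruct (Hd eps Heps) as (d1 & Hd1 & H1).
assert (Hm : 0 < Rmin d1 (Rmin (t - a) (b - t))) by (repeat apply Rmin_pos; lra).
assert (Hm1 : Rmin d1 (Rmin (t - a) (b - t)) <= d1) by apply Rmin_l.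
assert (Hm2 : Rmin d1 (Rmin (t - a) (b - t)) <= t - a) by (eapply Rle_trans; [apply Rmin_r | apply Rmin_l]).
assert (Hm3 : Rmin d1 (Rmin (t - a) (b - t)) <= b - t) by (eapply Rle_trans; [apply Rmin_r | apply Rmin_r]).
exists (mkposreal _ Hm). intros h Hh Hhm. simpl in Hhm.
assert (Hh' := Rabs_def2 _ _ Hhm).
assert (K := H1 (t + h)). simpl in K. unfold R_dist in K.
replace (t + h - t) with h in K by ring.
apply K. split; [split; [lra|]|]; lra.
Qed.

Lemma is_derive_D_in (f : R -> R) (l : R) (D : R -> Prop) (t : R) :
  is_derive f t l -> D_in f (fun _ => l) D t.
Proof.
intros H. apply (D_in_restrict f _ no_cond); [easy|].
apply (derivable_pt_lim_D_in f (fun _ => l)). apply is_derive_Reals. assumption.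
Qed.

Lemma D_in_ext_r (f d e : R -> R) (D : R -> Prop) (t : R) :
  d t = e t -> D_in f d D t -> D_in f e D t.
Proof. unfold D_in. intros ->. easy. Qed.

(** The fundamental theorem with one-sided derivatives at the ends: the clamped [f] is continuous,
    and its difference from a primitive of [g] has derivative 0 in the interior. *)
Lemma integral_of_D_in (f g : R -> R) (a b : R) : a <= b -> cts g ->
  (forall t, a <= t <= b -> D_in f g (fun s => a <= s <= b) t) ->
  forall t, a <= t <= b -> f t = f a + integral g a t.
Proof.
intros Hab Hg H t Ht.
assert (Hf : cts (fun t => f (clamp a b t))).
{ apply cts_clamp; [assumption|]. intros x Hx. apply (cont_deriv f g). apply H. assumption. }
set (F := fun t => f a + integral g a t).
assert (HF : forall t, is_derive F t (g t)) by (intros; apply is_derive_integral; assumption).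
assert (E := constant_of_derive (fun t => f (clamp a b t) - F t) a b).
assert (E' : f (clamp a b t) - F t = f (clamp a b a) - F a).
{ apply E; [|intros x Hx|assumption].
  - apply cts_minus; [assumption | eapply cts_derive; apply HF].
  - replace 0 with (g x - g x) by ring. apply (is_derive_minus (fun t => f (clamp a b t)) F); [|apply HF].
    apply (is_derive_ext_loc f).
    + assert (Hd : 0 < Rmin (x - a) (b - x)) by (apply Rmin_pos; lra).
      exists (mkposreal _ Hd). intros y Hy. simpl in Hy.
      assert (Hy' := Rabs_def2 _ _ Hy).
      assert (Hm1 := Rmin_l (x - a) (b - x)). assert (Hm2 := Rmin_r (x - a) (b - x)).
      unfold minus, plus, opp in Hy'; simpl in Hy'.
      rewrite clamp_id; [reflexivity|]. lra.
    + apply (D_in_is_derive f g a b); [assumption | apply H; lra]. }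
rewrite !clamp_id in E' by lra. unfold F in E'.
rewrite integral_point in E'. lra.
Qed.

(** * Heading functions *)

(** [kap] is the signed curvature; the integral form of [Th' = kap] avoids derivatives at break
    points. *)
Definition smooth_piece (rho : R) (Th : R -> R) (a b : R) : Prop :=
  exists kap, cts kap /\ (forall t, Rabs (kap t) <= / rho) /\
    forall t, a <= t <= b -> Th t = Th a + integral kap a t.

Inductive pieces (rho : R) (Th : R -> R) : R -> R -> Prop :=
| pieces_nil a : pieces rho Th a a
| pieces_cons a b c :
    a < b -> smooth_piece rho Th a b -> pieces rho Th b c -> pieces rho Th a c.

Lemma pieces_le (rho : R) (Th : R -> R) (a b : R) : pieces rho Th a b -> a <= b.
Proof. intros H; induction H; lra. Qed.

Lemma smooth_piece_shift (rho : R) (Th Th' : R -> R) (a b c d : R) :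
  a <= b -> (forall t, a <= t <= b -> Th' (t + c) = Th t + d) ->
  smooth_piece rho Th a b -> smooth_piece rho Th' (a + c) (b + c).
Proof.
intros Hab HE (kap & Hk & Hb & H). exists (fun t => kap (t - c)).
split; [|split].
- apply (cts_comp (fun t => t - c) kap); cts_tac.
- intros t. apply Hb.
- intros t Ht. replace t with ((t - c) + c) at 1 2 by ring.
  rewrite integral_shift, !HE by (assumption || lra). rewrite H by lra. ring.
Qed.

Lemma pieces_shift (rho : R) (Th Th' : R -> R) (a b c d : R) :
  (forall t, a <= t <= b -> Th' (t + c) = Th t + d) ->
  pieces rho Th a b -> pieces rho Th' (a + c) (b + c).
Proof.
intros HE H. induction H as [|a b e Hab Hs Hp IH]; [constructor|].
assert (Hbe := pieces_le _ _ _ _ Hp).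
apply pieces_cons with (b + c); [lra| |].
- apply (smooth_piece_shift rho Th Th' a b c d); [lra| |assumption].
  intros t Ht. apply HE. lra.
- apply IH. intros t Ht. apply HE. lra.
Qed.

Lemma pieces_ext (rho : R) (Th Th' : R -> R) (a b : R) :
  (forall t, a <= t <= b -> Th' t = Th t) -> pieces rho Th a b -> pieces rho Th' a b.
Proof.
intros HE H. rewrite <- (Rplus_0_r a), <- (Rplus_0_r b).
apply (pieces_shift rho Th Th' a b 0 0); [|assumption].
intros t Ht. rewrite !Rplus_0_r. apply HE, Ht.
Qed.

Lemma pieces_app (rho : R) (Th : R -> R) (a b c : R) :
  pieces rho Th a b -> pieces rho Th b c -> pieces rho Th a c.
Proof.
intros H1 H2. induction H1 as [|a b d Hab Hs Hp IH]; [assumption|].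
apply pieces_cons with b; auto.
Qed.

Lemma smooth_piece_split (rho : R) (Th : R -> R) (a b c : R) :
  a <= b <= c -> smooth_piece rho Th a c ->
  smooth_piece rho Th a b /\ smooth_piece rho Th b c.
Proof.
intros Hb (kap & Hk & Hbd & H). split; exists kap; repeat split; try assumption.
- intros t Ht. apply H. lra.
- intros t Ht. rewrite (H t), (H b) by lra. rewrite <- (integral_join kap a b t Hk). ring.
Qed.

Lemma pieces_split (rho : R) (Th : R -> R) (a b c : R) :
  a <= b <= c -> pieces rho Th a c -> pieces rho Th a b /\ pieces rho Th b c.
Proof.
intros Hb H. revert Hb. induction H as [a|a d c Had Hs Hp IH]; intros Hb.
- replace b with a by lra. split; constructor.
- assert (Hdc := pieces_le _ _ _ _ Hp).
  destruct (Rle_dec d b) as [Hdb|Hdb].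
  + destruct IH as [IH1 IH2]; [lra|]. split; [apply pieces_cons with d|]; assumption.
  + destruct (smooth_piece_split rho Th a b d) as [S1 S2]; [lra | assumption |].
    split; [|apply pieces_cons with d; try assumption; lra].
    destruct (Req_dec a b) as [<-|]; [constructor|].
    apply pieces_cons with b; [lra | assumption | constructor].
Qed.

(* [f phi] is the component of the displacement along the direction [- phi]. *)
Definition reach (rho th0 th1 T : R) (f : R -> R) : Prop :=
  exists Th, cts Th /\ pieces rho Th 0 T /\ Th 0 = th0 /\ Th T = th1 /\
    forall phi, f phi = integral (fun t => cos (Th t + phi)) 0 T.

Lemma reach_ext (rho th0 th1 T : R) (f g : R -> R) :
  (forall phi, g phi = f phi) -> reach rho th0 th1 T f -> reach rho th0 th1 T g.
Proof.
intros E (Th & H1 & H2 & H3 & H4 & H). exists Th. repeat split; try assumption.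
intros phi. rewrite E. apply H.
Qed.

Lemma reach_nil (rho th : R) : reach rho th th 0 (fun _ => 0).
Proof.
exists (fun _ => th). repeat split; [apply cts_const | constructor |].
intros phi. symmetry. apply (integral_point 0 (fun _ => cos (th + phi))).
Qed.

Lemma reach_cat (rho th0 th1 th2 T1 T2 : R) (f1 f2 : R -> R) :
  reach rho th0 th1 T1 f1 -> reach rho th1 th2 T2 f2 ->
  reach rho th0 th2 (T1 + T2) (fun phi => f1 phi + f2 phi).
Proof.
intros (Th1 & C1 & P1 & S1 & E1 & F1) (Th2 & C2 & P2 & S2 & E2 & F2).
assert (L1 := pieces_le _ _ _ _ P1). assert (L2 := pieces_le _ _ _ _ P2).
(* On each side of [T1] one of the two terms equals [th1], so the gluing is continuous by
   composition, without a case distinction. *)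
set (Th := fun t => Th1 (Rmin t T1) + Th2 (Rmax (t - T1) 0) - th1).
assert (A1 : forall t, t <= T1 -> Th t = Th1 t).
{ intros t Ht. unfold Th. rewrite Rmin_left, Rmax_right, S2 by lra. ring. }
assert (A2 : forall t, T1 <= t -> Th t = Th2 (t - T1)).
{ intros t Ht. unfold Th. rewrite Rmin_right, Rmax_left, E1 by lra. ring. }
assert (CT : cts Th).
{ unfold Th. apply cts_minus; [apply cts_plus|apply cts_const].
  - apply (cts_comp (fun t => Rmin t T1) Th1); [apply cts_Rmin | assumption].
  - apply (cts_comp (fun t => Rmax (t - T1) 0) Th2); [|assumption].
    apply (cts_comp (fun t => t - T1) (fun t => Rmax t 0)); [cts_tac | apply cts_Rmax]. }
exists Th. repeat split.
- assumption.
- apply pieces_app with T1.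
  + apply (pieces_ext rho Th1); [|assumption]. intros t Ht. apply A1. lra.
  + rewrite <- (Rplus_0_l T1) at 1. rewrite (Rplus_comm T1 T2).
    apply (pieces_shift rho Th2 Th 0 T2 T1 0); [|assumption].
    intros t Ht. rewrite A2 by lra. rewrite Rplus_0_r. f_equal; ring.
- rewrite A1 by lra. assumption.
- rewrite A2 by lra. rewrite <- E2. f_equal; ring.
- intros phi. rewrite F1, F2.
  rewrite <- (integral_join (fun t => cos (Th t + phi)) 0 T1 (T1 + T2)) by cts_tac.
  f_equal.
  + apply integral_ext. rewrite Rmin_left, Rmax_right by lra. intros t Ht. rewrite A1 by lra. reflexivity.
  + rewrite <- (integral_shift (fun t => cos (Th2 t + phi)) T1) by cts_tac.
    rewrite Rplus_0_l, (Rplus_comm T2 T1).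
    apply integral_ext. rewrite Rmin_left, Rmax_right by lra. intros t Ht. rewrite A2 by lra. reflexivity.
Qed.

Lemma reach_of_pieces (rho : R) (Th : R -> R) (a b : R) :
  cts Th -> pieces rho Th a b ->
  reach rho (Th a) (Th b) (b - a) (fun phi => integral (fun t => cos (Th t + phi)) a b).
Proof.
intros HC HP. exists (fun t => Th (t - - a)). repeat split.
- apply (cts_comp (fun t => t - - a) Th); cts_tac.
- replace 0 with (a + - a) by ring.
  apply (pieces_shift rho Th _ a b (- a) 0); [|assumption].
  intros t Ht. rewrite Rplus_0_r. f_equal; ring.
- f_equal; ring.
- f_equal; ring.
- intros phi. rewrite <- (integral_shift (fun t => cos (Th t + phi)) (- a)) by cts_tac.
  f_equal; ring.
Qed.

Definition slope (k : kind) : R := match k with KL => 1 | KR => -1 | KS => 0 end.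

Lemma turn_slope (k : kind) (x : R) : turn (k, x) = slope k * x.
Proof. destruct k; unfold turn; simpl; ring. Qed.

Lemma integral_linear (rho th a phi : R) (k : kind) (x : R) : 0 < rho ->
  integral (fun t => cos (th + slope k / rho * (t - a) + phi)) a (a + rho * x) =
  rho * disp1 (th + phi) (k, x).
Proof.
intros Hrho.
assert (HC : forall c, c <> 0 -> integral (fun t => cos (th + c * (t - a) + phi)) a (a + rho * x) =
  / c * (sin (th + phi + c * rho * x) - sin (th + phi))).
{ intros c Hc. rewrite (integral_of_derive (fun t => / c * sin (th + c * (t - a) + phi))); [|intros t|cts_tac].
  - replace (th + c * (a + rho * x - a) + phi) with (th + phi + c * rho * x) by ring.
    replace (th + c * (a - a) + phi) with (th + phi) by ring. ring.
  - auto_derive; [exact I | unfold Rminus; field; assumption]. }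
destruct k; unfold disp1; simpl.
- rewrite HC by (apply Rgt_not_eq, Rdiv_lt_0_compat; lra).
  replace (1 / rho * rho * x) with x by (field; lra). field. lra.
- rewrite HC by (apply Rlt_not_eq; unfold Rdiv; assert (0 < / rho) by (apply Rinv_0_lt_compat; lra); lra).
  replace (th + phi + -1 / rho * rho * x) with (th + phi - x) by (field; lra).
  replace (/ (-1 / rho)) with (- rho) by (field; lra). ring.
- rewrite (integral_ext _ (fun _ => cos (th + phi))).
  + rewrite integral_const_R. ring.
  + intros t _. replace (th + 0 / rho * (t - a) + phi) with (th + phi) by (field; lra). reflexivity.
Qed.

Lemma reach_seg (rho th : R) (s : seg) : 0 < rho -> 0 <= snd s ->
  reach rho th (th + turn s) (rho * snd s) (fun phi => rho * disp1 (th + phi) s).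
Proof.
intros Hrho Hs. destruct s as [k x]; simpl in Hs.
exists (fun t => th + slope k / rho * (t - 0)). repeat split.
- cts_tac.
- simpl snd. destruct (Req_dec x 0) as [->|Hx].
  { rewrite Rmult_0_r. constructor. }
  apply pieces_cons with (rho * x); [|exists (fun _ => slope k / rho)|constructor].
  + apply Rmult_lt_0_compat; lra.
  + repeat split.
    * apply cts_const.
    * intros t. unfold Rdiv. rewrite Rabs_mult.
      assert (0 < / rho) by (apply Rinv_0_lt_compat; assumption).
      rewrite (Rabs_pos_eq (/ rho)) by lra.
      rewrite <- (Rmult_1_l (/ rho)) at 2. apply Rmult_le_compat_r; [lra|].
      apply Rabs_le. destruct k; simpl; lra.
    * intros t Ht. rewrite integral_const_R. ring.
- ring.
- rewrite turn_slope. simpl. field. lra.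
- intros phi. simpl snd. rewrite <- (integral_linear rho th 0) by assumption.
  rewrite Rplus_0_l. reflexivity.
Qed.

Lemma reach_list (rho th : R) (l : list seg) : 0 < rho -> valid l ->
  reach rho th (th + ang l) (rho * tot l) (fun phi => rho * disp (th + phi) l).
Proof.
intros Hrho Hv. revert th. induction Hv as [|s l Hs Hv IH]; intros th; simpl.
- rewrite Rplus_0_r, Rmult_0_r. eapply reach_ext; [|apply reach_nil]. intros phi; simpl; ring.
- rewrite <- Rplus_assoc, Rmult_plus_distr_l.
  eapply reach_ext; [|apply (reach_cat rho th (th + turn s)); [apply reach_seg; assumption | apply IH]].
  intros phi. simpl. rewrite Rmult_plus_distr_l.
  replace (th + turn s + phi) with (th + phi + turn s) by ring. reflexivity.
Qed.

(** * Shortest heading functions *)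

(* The time spent at each heading in excess of the minimum [rho] per radian is
   moved to a single heading [x]. *)
Lemma slow_left_turn (rho a b : R) (th kap : R -> R) :
  0 < rho -> a < b -> b - a <= rho ->
  (forall t, is_derive th t (kap t)) -> cts kap ->
  (forall t, a <= t <= b -> 0 < kap t < / rho) ->
  exists l, valid l /\ 0 < tot l /\ rho * tot l < b - a /\ ang l = th b - th a /\
    forall phi, rho * disp (th a + phi) l = integral (fun t => cos (th t + phi)) a b.
Proof.
intros Hrho Hab Hba Hth Hk Hkap. assert (P2 := PI2_1).
assert (Hcth : cts th) by (eapply cts_derive; apply Hth).
set (g := fun t => th t - th a).
assert (Hg : cts g) by (unfold g; cts_tac).
assert (Hgint : forall c d, integral kap c d = g d - g c).
{ intros c d. rewrite (integral_of_derive th kap c d Hth Hk). unfold g. ring. }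
assert (Hmono : forall c d, a <= c -> c <= d -> d <= b -> g c <= g d).
{ intros c d Hc Hcd Hd. enough (0 <= integral kap c d) by (rewrite Hgint in H; lra).
  apply integral_nonneg; try assumption. intros t Ht. assert (Ht' := Hkap t ltac:(lra)). lra. }
assert (Hga : g a = 0) by (unfold g; ring).
(* Per unit of time, [rho * kap] is what an arc of radius [rho] needs for the same turn, and [w] is
   the excess. *)
set (w := fun t => 1 - rho * kap t).
assert (Hw : cts w) by (unfold w; cts_tac).
assert (Hwpos : forall t, a <= t <= b -> 0 < w t).
{ intros t Ht. destruct (Hkap t Ht) as [_ H]. unfold w.
  apply (Rmult_lt_compat_l rho) in H; [|assumption]. rewrite Rinv_r in H by lra. lra. }
assert (Hwint : integral w a b = (b - a) - rho * g b).
{ transitivity (integral (fun _ => 1) a b + integral (fun t => - rho * kap t) a b).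
  - rewrite <- integral_add by cts_tac. apply integral_ext. intros t _. unfold w. ring.
  - rewrite integral_mulc, integral_const_R, Hgint, Hga by assumption. ring. }
assert (HD0 : 0 < g b).
{ enough (0 < integral kap a b) by (rewrite Hgint in H; lra).
  apply (integral_pos kap a b a); try assumption; try lra.
  - intros t Ht. assert (H := Hkap t Ht). lra.
  - apply Hkap; lra. }
assert (HD1 : rho * g b < b - a).
{ enough (0 < integral w a b) by lra.
  apply (integral_pos w a b a); try assumption; try lra.
  - intros t Ht. assert (H := Hwpos t Ht). lra.
  - apply Hwpos; lra. }
(* Here [b - a <= rho] enters: the turn stays below one radian, which fixes the signs of the sines
   and cosines below. *)
assert (HD2 : g b < 1).
{ apply (Rmult_lt_reg_l rho); lra. }
(* [(B, A)] is the displacement made in the excess time, in coordinates along and to the left of the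
   initial heading; [x] and [M] will be its polar coordinates. *)
set (A := integral (fun t => sin (g t) * w t) a b).
set (B := integral (fun t => cos (g t) * w t) a b).
assert (Hrot : forall y z, integral (fun t => (y * cos (g t) + z * sin (g t)) * w t) a b = y * B + z * A).
{ intros y z. unfold A, B. rewrite <- (integral_mulc y), <- (integral_mulc z) by cts_tac.
  rewrite <- integral_add by cts_tac. apply integral_ext. intros t _. ring. }
assert (Hgr : forall t, a <= t <= b -> 0 <= g t <= g b).
{ intros t Ht. rewrite <- Hga at 1. split; apply Hmono; lra. }
assert (HA : 0 <= A).
{ apply integral_nonneg; [lra | cts_tac |]. intros t Ht.
  assert (H1 := Hgr t Ht). assert (H2 := Hwpos t Ht).
  apply Rmult_le_pos; [apply sin_ge_0|]; lra. }
assert (HB : 0 < B).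
{ assert (Hcpos : forall t, a <= t <= b -> 0 < cos (g t) * w t).
  { intros t Ht. assert (H1 := Hgr t Ht). assert (H2 := Hwpos t Ht).
    apply Rmult_lt_0_compat; [apply cos_gt_0|]; lra. }
  apply (integral_pos _ a b a); [lra | cts_tac | | lra | apply Hcpos; lra].
  intros t Ht. left. apply Hcpos, Ht. }
set (x := atan (A / B)).
assert (Hx := atan_bound (A / B)). fold x in Hx.
assert (Hcx : 0 < cos x) by (apply cos_gt_0; lra).
set (M := B / cos x).
assert (HMc : M * cos x = B) by (unfold M; field; lra).
assert (HMs : M * sin x = A).
{ assert (Ht : sin x / cos x = A / B) by apply tan_atan.
  unfold M. replace (B / cos x * sin x) with (B * (sin x / cos x)) by (field; lra).
  rewrite Ht. field. lra. }
assert (HM : 0 < M) by (apply Rdiv_lt_0_compat; assumption).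
assert (Hx0 : 0 <= x).
{ apply Rnot_lt_le. intros H. assert (sin x < 0) by (apply sin_lt_0_var; lra).
  assert (0 < M * - sin x) by (apply Rmult_lt_0_compat; lra). lra. }
(* No heading on the way lies to the left of the final one, so neither does the excess vector; thus
   the turn passes the heading [x]. *)
assert (HxD : x <= g b).
{ assert (H : cos (g b) * A - sin (g b) * B <= 0).
  { replace (cos (g b) * A - sin (g b) * B) with (- (sin (g b) * B + - cos (g b) * A)) by ring.
    rewrite <- Hrot.
    enough (0 <= integral (fun t => (sin (g b) * cos (g t) + - cos (g b) * sin (g t)) * w t) a b) by lra.
    apply integral_nonneg; [lra | cts_tac |]. intros t Ht.
    replace (sin (g b) * cos (g t) + - cos (g b) * sin (g t)) with (sin (g b - g t))
      by (rewrite sin_minus; ring).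
    assert (H1 := Hgr t Ht). assert (H2 := Hwpos t Ht).
    apply Rmult_le_pos; [apply sin_ge_0|]; lra. }
  rewrite <- HMs, <- HMc in H. apply Rnot_lt_le. intros Hlt.
  assert (0 < sin (x - g b)) by (apply sin_gt_0; lra).
  assert (0 < M * sin (x - g b)) by (apply Rmult_lt_0_compat; lra).
  rewrite sin_minus in *. lra. }
(* Strict triangle inequality: [1 - cos (g t - x)] is positive at an end of the turn whose heading
   is not [x]. *)
assert (HMw : M < integral w a b).
{ assert (Hcos : M = integral (fun t => cos (g t - x) * w t) a b).
  { transitivity (cos x * B + sin x * A).
    - rewrite <- HMs, <- HMc. assert (H := sin2_cos2 x). unfold Rsqr in H.
      replace (cos x * (M * cos x) + sin x * (M * sin x)) with (M * (sin x * sin x + cos x * cos x)) by ring.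
      rewrite H. ring.
    - rewrite <- Hrot. apply integral_ext. intros t _. rewrite cos_minus. f_equal. ring. }
  assert (Hdiff : integral w a b - M = integral (fun t => (1 - cos (g t - x)) * w t) a b).
  { rewrite Hcos. transitivity (integral w a b + integral (fun t => -1 * (cos (g t - x) * w t)) a b).
    - rewrite integral_mulc by cts_tac. ring.
    - rewrite <- integral_add by cts_tac. apply integral_ext. intros t _. ring. }
  enough (0 < integral (fun t => (1 - cos (g t - x)) * w t) a b) by lra.
  assert (Hlt1 : forall y, y <> 0 -> -1 <= y <= 1 -> cos y < 1).
  { intros y Hy0 Hy. rewrite <- cos_0. destruct (Rlt_dec y 0).
    - rewrite <- (cos_neg y). apply cos_decreasing_1; lra.
    - apply cos_decreasing_1; lra. }
  assert (Hpos : forall t, a <= t <= b -> 0 <= (1 - cos (g t - x)) * w t).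
  { intros t Ht. assert (H := COS_bound (g t - x)). assert (H2 := Hwpos t Ht).
    apply Rmult_le_pos; lra. }
  destruct (Req_dec x 0) as [Hx00|Hx00].
  - apply (integral_pos _ a b b); [lra | cts_tac | assumption | lra |].
    apply Rmult_lt_0_compat; [|apply Hwpos; lra].
    enough (cos (g b - x) < 1) by lra. apply Hlt1; lra.
  - apply (integral_pos _ a b a); [lra | cts_tac | assumption | lra |].
    apply Rmult_lt_0_compat; [|apply Hwpos; lra].
    enough (cos (g a - x) < 1) by lra. apply Hlt1; lra. }
assert (HMr : 0 < M / rho) by (apply Rdiv_lt_0_compat; assumption).
exists [(KL, x); (KS, M / rho); (KL, g b - x)].
repeat split.
- valid_tac.
- simpl. lra.
- simpl. replace (rho * (x + (M / rho + (g b - x + 0)))) with (M + rho * g b) by (field; lra). lra.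
- simpl. unfold turn; simpl. unfold g. ring.
- intros phi. rewrite disp_LSL. replace (x + (g b - x)) with (g b) by ring.
  simpl disp. unfold disp1; simpl.
  transitivity (integral (fun t => rho * (cos (th t + phi) * kap t)) a b +
    integral (fun t => cos (th t + phi) * w t) a b).
  2:{ rewrite <- integral_add by cts_tac. apply integral_ext. intros t _. unfold w. ring. }
  rewrite integral_mulc by cts_tac.
  rewrite (integral_of_derive (fun t => sin (th t + phi))); [|intros t|cts_tac].
  2:{ replace (cos (th t + phi) * kap t) with (kap t * cos (th t + phi)) by ring.
      apply (is_derive_comp sin (fun t => th t + phi)).
      - apply is_derive_Reals, derivable_pt_lim_sin.
      - rewrite <- (Rplus_0_r (kap t)).
        apply (is_derive_plus th (fun _ => phi)); [apply Hth | apply (is_derive_const (V := R_NormedModule))]. }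
  replace (integral (fun t => cos (th t + phi) * w t) a b)
    with (cos (th a + phi) * B + - sin (th a + phi) * A).
  2:{ rewrite <- Hrot. apply integral_ext. intros t _.
      replace (th t + phi) with (g t + (th a + phi)) by (unfold g; ring).
      rewrite (cos_plus (g t)). ring. }
  rewrite <- HMs, <- HMc.
  replace (th b + phi) with (th a + phi + g b) by (unfold g; ring).
  rewrite cos_plus. field. lra.
Qed.

Lemma slow_turn (rho a b : R) (th kap : R -> R) :
  0 < rho -> a < b -> b - a <= rho ->
  (forall t, is_derive th t (kap t)) -> cts kap ->
  (forall t, a <= t <= b -> 0 < kap t < / rho) \/
  (forall t, a <= t <= b -> - / rho < kap t < 0) ->
  exists l, valid l /\ 0 < tot l /\ rho * tot l < b - a /\ ang l = th b - th a /\
    forall phi, rho * disp (th a + phi) l = integral (fun t => cos (th t + phi)) a b.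
Proof.
intros Hrho Hab Hba Hth Hk [H|H]; [apply slow_left_turn with kap; assumption|].
destruct (slow_left_turn rho a b (fun t => - th t) (fun t => - kap t)) as (l & Hv & Ht & Hl & Ha & HD);
  try assumption.
- intros t. apply (is_derive_opp th), Hth.
- cts_tac.
- intros t Ht. assert (H' := H t Ht). lra.
- exists (mirror l). rewrite tot_mirror, ang_mirror. repeat split; try assumption; try lra.
  + apply (Forall_mirror (fun x => 0 <= x)). assumption.
  + intros phi. rewrite disp_mirror. replace (- (th a + phi)) with (- th a + - phi) by ring.
    rewrite HD. apply integral_ext. intros t _. rewrite <- cos_neg. f_equal. ring.
Qed.

Definition minimal (rho : R) (ok : R -> Prop) (Th : R -> R) (T : R) : Prop :=
  forall T' th f, 0 < T' -> reach rho (Th 0) th T' f ->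
    (forall phi, f phi = integral (fun t => cos (Th t + phi)) 0 T) -> ok th -> T <= T'.

(** As [l] keeps the turn and the displacement, the parts before [a] and after [b] can be reattached
    unchanged. *)
Lemma minimal_subpath (rho : R) (ok : R -> Prop) (Th : R -> R) (T a b : R) (l : list seg) :
  0 < rho -> cts Th -> pieces rho Th 0 T -> ok (Th T) -> minimal rho ok Th T ->
  0 <= a <= b -> b <= T -> valid l -> 0 < tot l -> ang l = Th b - Th a ->
  (forall phi, rho * disp (Th a + phi) l = integral (fun t => cos (Th t + phi)) a b) ->
  b - a <= rho * tot l.
Proof.
intros Hrho HC HP Hok Hmin Hab HbT Hv Ht Ha HD.
destruct (pieces_split rho Th 0 a T ltac:(lra) HP) as [P1 P2].
destruct (pieces_split rho Th a b T ltac:(lra) P2) as [_ P3].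
assert (R1 := reach_of_pieces rho Th 0 a HC P1).
assert (R3 := reach_of_pieces rho Th b T HC P3).
assert (R2 := reach_list rho (Th a) l Hrho Hv).
replace (Th a + ang l) with (Th b) in R2 by lra.
assert (Rc := reach_cat _ _ _ _ _ _ _ _ R1 (reach_cat _ _ _ _ _ _ _ _ R2 R3)).
assert (T <= a - 0 + (rho * tot l + (T - b))); [|lra].
refine (Hmin _ _ _ _ Rc _ Hok).
- assert (0 < rho * tot l) by (apply Rmult_lt_0_compat; lra). lra.
- intros phi. simpl. rewrite HD, !integral_join by cts_tac. reflexivity.
Qed.

Lemma minimal_bang_bang (rho : R) (ok : R -> Prop) (Th kap : R -> R) (T a b t : R) :
  0 < rho -> cts Th -> pieces rho Th 0 T -> ok (Th T) -> minimal rho ok Th T ->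
  0 <= a -> b <= T -> cts kap -> (forall t, Rabs (kap t) <= / rho) ->
  (forall t, a <= t <= b -> Th t = Th a + integral kap a t) ->
  a < t < b -> kap t = 0 \/ kap t = / rho \/ kap t = - / rho.
Proof.
intros Hrho HC HP Hok Hmin Ha HbT Hk Hkb HTh Ht.
assert (Hb := Hkb t). apply Rabs_le_between in Hb.
destruct (Req_dec (kap t) 0) as [|H0]; [now left|].
destruct (Req_dec (kap t) (/ rho)) as [|H1]; [now right; left|].
destruct (Req_dec (kap t) (- / rho)) as [|H2]; [now right; right|].
exfalso.
assert (exists d, 0 < d /\
  ((forall x, Rabs (x - t) < d -> 0 < kap x < / rho) \/
   (forall x, Rabs (x - t) < d -> - / rho < kap x < 0))) as (d & Hd & Hnear).
{ destruct (Rlt_dec 0 (kap t)).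
  - destruct (cts_pos_near kap t Hk) as (d1 & Hd1 & N1); [lra|].
    destruct (cts_pos_near (fun x => / rho - kap x) t) as (d2 & Hd2 & N2); [cts_tac|lra|].
    exists (Rmin d1 d2). split; [apply Rmin_pos; assumption|]. left. intros x Hx.
    assert (E1 := Rmin_l d1 d2). assert (E2 := Rmin_r d1 d2).
    assert (F1 := N1 x ltac:(lra)). assert (F2 := N2 x ltac:(lra)). lra.
  - destruct (cts_pos_near (fun x => - kap x) t) as (d1 & Hd1 & N1); [cts_tac|lra|].
    destruct (cts_pos_near (fun x => / rho + kap x) t) as (d2 & Hd2 & N2); [cts_tac|lra|].
    exists (Rmin d1 d2). split; [apply Rmin_pos; assumption|]. right. intros x Hx.
    assert (E1 := Rmin_l d1 d2). assert (E2 := Rmin_r d1 d2).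
    assert (F1 := N1 x ltac:(lra)). assert (F2 := N2 x ltac:(lra)). lra. }
(* [h <= rho] is required by [slow_turn]; the other bounds keep [[t, t + h]] within the
   neighbourhood and within [[a, b]]. *)
set (h := Rmin (Rmin (d / 2) (b - t)) rho).
assert (Hh : 0 < h) by (unfold h; repeat apply Rmin_pos; lra).
assert (Hh1 : h <= rho) by apply Rmin_r.
assert (Hh2 : h <= d / 2) by (eapply Rle_trans; apply Rmin_l).
assert (Hh3 : h <= b - t) by (eapply Rle_trans; [apply Rmin_l | apply Rmin_r]).
set (th := fun s => Th a + integral kap a s).
destruct (slow_turn rho t (t + h) th kap) as (l & Hv & Hl & Hlen & Hang & HD); try assumption; try lra.
- intros s. apply is_derive_integral. assumption.
- destruct Hnear as [Hnear|Hnear]; [left|right]; intros s Hs; apply Hnear; apply Rabs_def1; lra.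
- enough (t + h - t <= rho * tot l) by lra.
  apply (minimal_subpath rho ok Th T); try assumption; try lra.
  + rewrite (HTh (t + h)), (HTh t) by lra. exact Hang.
  + intros phi. rewrite (HTh t) by lra. fold (th t). rewrite HD.
    apply integral_ext. rewrite Rmin_left, Rmax_right by lra. intros s Hs.
    rewrite (HTh s) by lra. reflexivity.
Qed.

Definition linear_piece (rho : R) (Th : R -> R) (a b : R) (k : kind) : Prop :=
  forall t, a <= t <= b -> Th t = Th a + slope k / rho * (t - a).

Lemma minimal_linear (rho : R) (ok : R -> Prop) (Th : R -> R) (T a b : R) :
  0 < rho -> cts Th -> pieces rho Th 0 T -> ok (Th T) -> minimal rho ok Th T ->
  0 <= a -> a < b -> b <= T -> smooth_piece rho Th a b -> exists k, linear_piece rho Th a b k.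
Proof.
intros Hrho HC HP Hok Hmin Ha Hab HbT (kap & Hk & Hkb & HTh).
assert (Hi : 0 < / rho) by (apply Rinv_0_lt_compat; assumption).
assert (Hv : forall t, a < t < b -> kap t = 0 \/ kap t = / rho \/ kap t = - / rho).
{ intros t Ht. apply (minimal_bang_bang rho ok Th kap T a b); assumption. }
set (m := (a + b) / 2).
assert (Hm : a < m < b) by (unfold m; lra).
assert (Hconst : forall t, a < t < b -> kap t = kap m).
{ intros t Ht. destruct (Req_dec (kap t) (kap m)) as [|Hne]; [assumption|exfalso].
  (* The weights are unequal because the midpoint of [/ rho] and [- / rho] is the allowed value 0;
     with 3/4 and 1/4 the intermediate value is never allowed. *)
  destruct (IVT_gen kap t m (3 / 4 * kap t + / 4 * kap m)) as (c & Hc & Hkc).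
  - intros x. apply cts_continuity_pt, Hk.
  - unfold Rmin, Rmax. repeat destruct Rle_dec; lra.
  - assert (Hc' : a < c < b).
    { revert Hc. unfold Rmin, Rmax. repeat destruct Rle_dec; lra. }
    destruct (Hv c Hc') as [E|[E|E]], (Hv t Ht) as [E1|[E1|E1]], (Hv m Hm) as [E2|[E2|E2]]; lra. }
assert (exists k, kap m = slope k / rho) as [k Hkm].
{ destruct (Hv m Hm) as [E|[E|E]]; rewrite E; [exists KS|exists KL|exists KR]; simpl; field; lra. }
exists k. intros t Ht. rewrite (HTh t) by assumption. f_equal.
rewrite <- integral_const_R. apply integral_ext. rewrite Rmin_left, Rmax_right by lra.
intros x Hx. rewrite <- Hkm. apply Hconst. lra.
Qed.

Fixpoint follows (rho : R) (Th : R -> R) (a : R) (l : list seg) (b : R) : Prop :=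
  match l with
  | [] => a = b
  | s :: l' => 0 < snd s /\ linear_piece rho Th a (a + rho * snd s) (fst s) /\
      follows rho Th (a + rho * snd s) l' b
  end.

Lemma follows_all_pos (rho : R) (Th : R -> R) (a b : R) (l : list seg) :
  follows rho Th a l b -> all_pos l.
Proof.
revert a; induction l as [|s l IH]; intros a H; constructor; destruct H as (H1 & _ & H2);
  [assumption | eapply IH; eassumption].
Qed.

Lemma linear_join (rho : R) (Th : R -> R) (a b c : R) (k : kind) :
  a <= b -> linear_piece rho Th a b k -> linear_piece rho Th b c k -> linear_piece rho Th a c k.
Proof.
intros Hab H1 H2 t Ht. destruct (Rle_dec t b).
- apply H1. lra.
- rewrite H2, (H1 b) by lra. ring.
Qed.

Lemma follows_distinct (rho : R) (Th : R -> R) (a b : R) (l : list seg) : 0 < rho ->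
  follows rho Th a l b -> exists l', follows rho Th a l' b /\ distinct l'.
Proof.
intros Hrho. revert a. induction l as [|[k x] l IH]; intros a H.
- exists []. split; [assumption | exact I].
- destruct H as (Hx & Hlin & H). simpl in *.
  destruct (IH _ H) as ([|[k' x'] l'] & H' & Hd).
  + exists ((k, x) :: nil). repeat split; assumption.
  + assert (Hcmp : {k = k'} + {k <> k'}) by decide equality.
    destruct Hcmp as [<-|Hne].
    * exists ((k, x + x') :: l'). destruct H' as (Hx' & Hlin' & H').
      simpl in *. replace (a + rho * (x + x')) with (a + rho * x + rho * x') by ring.
      repeat split; [lra| |assumption|].
      -- apply linear_join with (a + rho * x); try assumption.
         assert (0 < rho * x) by (apply Rmult_lt_0_compat; assumption). lra.
      -- destruct l' as [|[k'' x''] l']; [exact I|]. exact Hd.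
    * exists ((k, x) :: (k', x') :: l'). repeat split; try assumption; apply H'.
Qed.

Lemma pieces_follows (rho : R) (Th : R -> R) (a b : R) : 0 < rho ->
  (forall c d, a <= c -> c < d -> d <= b -> smooth_piece rho Th c d ->
    exists k, linear_piece rho Th c d k) ->
  pieces rho Th a b -> exists l, follows rho Th a l b.
Proof.
intros Hrho Hlin HP. induction HP as [a|a b c Hab Hs Hp IH].
- exists []. reflexivity.
- assert (Hbc := pieces_le _ _ _ _ Hp).
  destruct (Hlin a b) as [k Hk]; try assumption; try lra.
  destruct IH as [l Hl]; [intros; apply Hlin; try assumption; lra|].
  exists ((k, (b - a) / rho) :: l). simpl.
  replace (a + rho * ((b - a) / rho)) with b by (field; lra).
  repeat split; try assumption. apply Rdiv_lt_0_compat; lra.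
Qed.

Lemma minimal_follows (rho : R) (ok : R -> Prop) (Th : R -> R) (T : R) :
  0 < rho -> cts Th -> pieces rho Th 0 T -> ok (Th T) -> minimal rho ok Th T ->
  exists l, follows rho Th 0 l T /\ distinct l.
Proof.
intros Hrho HC HP Hok Hmin.
destruct (pieces_follows rho Th 0 T) as [l Hl]; try assumption.
- intros a b. apply (minimal_linear rho ok Th T); assumption.
- apply (follows_distinct _ _ _ _ l); assumption.
Qed.

Lemma follows_reach (rho : R) (Th : R -> R) (a b : R) (l : list seg) : 0 < rho -> cts Th ->
  follows rho Th a l b ->
  b = a + rho * tot l /\ Th b = Th a + ang l /\
  forall phi, integral (fun t => cos (Th t + phi)) a b = rho * disp (Th a + phi) l.
Proof.
intros Hrho HC. revert a. induction l as [|[k x] l IH]; intros a H; simpl in H.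
- subst b. simpl. repeat split; try ring.
  intros phi. rewrite Rmult_0_r. apply (integral_point a (fun t => cos (Th t + phi))).
- destruct H as (Hx & Hlin & H). destruct (IH _ H) as (Hb & Hang & HD).
  assert (Hrx : 0 < rho * x) by (apply Rmult_lt_0_compat; assumption).
  assert (E : Th (a + rho * x) = Th a + turn (k, x)).
  { rewrite Hlin, turn_slope by lra. field. lra. }
  repeat split.
  + rewrite Hb. simpl. ring.
  + rewrite Hang, E. simpl. ring.
  + intros phi. rewrite <- (integral_join _ a (a + rho * x) b) by cts_tac.
    rewrite HD, E. simpl disp. rewrite Rmult_plus_distr_l.
    replace (Th a + turn (k, x) + phi) with (Th a + phi + turn (k, x)) by ring. f_equal.
    rewrite <- (integral_linear rho (Th a) a) by assumption.
    apply integral_ext. rewrite Rmin_left, Rmax_right by lra. intros t Ht.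
    rewrite Hlin by lra. reflexivity.
Qed.

Lemma minimal_optimal (rho : R) (ok : R -> Prop) (Th : R -> R) (T : R) (l : list seg) :
  0 < rho -> cts Th -> ok (Th T) -> minimal rho ok Th T -> follows rho Th 0 l T ->
  optimal (fun x => ok (Th 0 + x)) l.
Proof.
intros Hrho HC Hok Hmin Hl. destruct (follows_reach rho Th 0 T l Hrho HC Hl) as (HT & Ha & HD).
split.
- rewrite <- Ha. assumption.
- intros l' Hv Ht HE Hok'. apply (Rmult_le_reg_l rho); [assumption|].
  replace (rho * tot l) with T by lra.
  apply (Hmin _ (Th 0 + ang l') (fun phi => rho * disp (Th 0 + phi) l')); try assumption.
  + apply Rmult_lt_0_compat; assumption.
  + apply reach_list; assumption.
  + intros phi. rewrite HE, HD. reflexivity.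
Qed.

(** * From paths to heading functions and back *)

Lemma cont_on_cts (a b : R) (f : R -> R) : cts f -> cont_on a b f.
Proof.
intros Hf t _. apply (limit1_imp f (D_x no_cond t)).
- intros x [_ Hx]. split; [exact I | assumption].
- apply (cts_continuity_pt f Hf t).
Qed.

Lemma deriv_on_of_derive (a b : R) (f df e : R -> R) :
  (forall t, is_derive f t (df t)) -> (forall t, a <= t <= b -> df t = e t) -> deriv_on a b f e.
Proof.
intros Hf He t Ht. apply (D_in_ext_r f (fun _ => df t)); [apply He, Ht|].
apply is_derive_D_in, Hf.
Qed.

Lemma heading_ext (p : path) (t th th' : R) :
  cos th = cos th' -> sin th = sin th' -> heading p t th -> heading p t th'.
Proof.
intros Hc Hs [H1 H2]. split.
- apply (D_in_ext_r _ (fun _ => cos th)); assumption.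
- apply (D_in_ext_r _ (fun _ => sin th)); assumption.
Qed.

Lemma heading_unique (p : path) (t th th' : R) : 0 < len p -> 0 <= t <= len p ->
  heading p t th -> heading p t th' -> cos th = cos th' /\ sin th = sin th'.
Proof.
intros Hl Ht [H1 H2] [H1' H2']. split.
- exact (D_in_unique (px p) _ _ 0 (len p) t Hl Ht H1 H1').
- exact (D_in_unique (py p) _ _ 0 (len p) t Hl Ht H2 H2').
Qed.

Lemma heading_velocity (p : path) (a b t th : R) (u v : R -> R) :
  0 <= a -> a < b -> b <= len p -> a <= t <= b ->
  deriv_on a b (px p) u -> deriv_on a b (py p) v -> heading p t th ->
  u t = cos th /\ v t = sin th.
Proof.
intros Ha Hab Hb Ht Hu Hv [H1 H2]. split.
- apply (D_in_unique (px p) u (fun _ => cos th) a b t Hab Ht (Hu t Ht)).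
  apply (D_in_restrict _ _ (fun s => 0 <= s <= len p)); [intros; lra | assumption].
- apply (D_in_unique (py p) v (fun _ => sin th) a b t Hab Ht (Hv t Ht)).
  apply (D_in_restrict _ _ (fun s => 0 <= s <= len p)); [intros; lra | assumption].
Qed.

(** The integral of the signed curvature is a heading because the inner product of the velocity with
    the unit vector of that angle is 1 at [a] and constant. *)
Lemma heading_piece (rho : R) (p : path) (a b th : R) :
  unit_speed p -> 0 <= a -> a < b -> b <= len p -> C2_radius_ge rho p a b -> heading p a th ->
  exists kap, cts kap /\ (forall t, Rabs (kap t) <= / rho) /\
    forall t, a <= t <= b -> heading p t (th + integral kap a t).
Proof.
intros Hus Ha Hab Hb (u & v & u' & v' & Hu & Hu' & Cu' & Hv & Hv' & Cv' & Hcurv) Hth.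
assert (Hvel : forall t th, a <= t <= b -> heading p t th -> u t = cos th /\ v t = sin th).
{ intros t th' Ht. apply (heading_velocity p a b t th' u v); assumption. }
assert (Hunit : forall t, a <= t <= b -> u t * u t + v t * v t = 1).
{ intros t Ht. destruct (Hus t ltac:(lra)) as [th' H]. destruct (Hvel t th' Ht H) as [-> ->].
  assert (E := sin2_cos2 th'). unfold Rsqr in E. lra. }
assert (Hext : forall f f', deriv_on a b f f' -> cont_on a b f' ->
  cts (fun t => f (clamp a b t)) /\ cts (fun t => f' (clamp a b t)) /\
  forall t, a <= t <= b -> f t = f a + integral (fun t => f' (clamp a b t)) a t).
{ intros f f' Hf Cf'. split; [|split].
  - apply cts_clamp; [lra|]. intros t Ht. apply (cont_deriv f f'), Hf, Ht.
  - apply cts_clamp; [lra | assumption].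
  - apply integral_of_D_in; [lra | apply cts_clamp; [lra | assumption] |].
    intros t Ht. apply (D_in_ext_r f f'); [|apply Hf, Ht].
    rewrite clamp_id by assumption. reflexivity. }
destruct (Hext u u' Hu' Cu') as (Cuc & Cu'c & Eu). destruct (Hext v v' Hv' Cv') as (Cvc & Cv'c & Ev).
set (kap := fun t => u (clamp a b t) * v' (clamp a b t) - v (clamp a b t) * u' (clamp a b t)).
assert (Ck : cts kap) by (unfold kap; cts_tac).
exists kap. split; [assumption|split].
{ intros t. apply Hcurv, clamp_in. lra. }
(* [U] and [V] agree with [u] and [v] on [[a, b]] and have two-sided derivatives everywhere. *)
set (U := fun t => u a + integral (fun t => u' (clamp a b t)) a t).
set (V := fun t => v a + integral (fun t => v' (clamp a b t)) a t).
set (Th := fun t => th + integral kap a t).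
assert (DU : forall t, is_derive U t (u' (clamp a b t))) by (intros t; apply (is_derive_integral (fun t => u' (clamp a b t))); assumption).
assert (DV : forall t, is_derive V t (v' (clamp a b t))) by (intros t; apply (is_derive_integral (fun t => v' (clamp a b t))); assumption).
assert (DT : forall t, is_derive Th t (kap t)) by (intros t; apply is_derive_integral; assumption).
assert (CU : cts U) by (eapply cts_derive; apply DU).
assert (CV : cts V) by (eapply cts_derive; apply DV).
assert (CT : cts Th) by (eapply cts_derive; apply DT).
assert (Horth : forall t, a < t < b -> u t * u' t + v t * v' t = 0).
{ intros t Ht.
  assert (D1 : is_derive (fun t => U t * U t + V t * V t) t
    ((u' (clamp a b t) * U t + U t * u' (clamp a b t)) + (v' (clamp a b t) * V t + V t * v' (clamp a b t)))).
  { apply (is_derive_plus (fun t => U t * U t) (fun t => V t * V t)).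
    - apply (is_derive_mult U U); [apply DU | apply DU | intros; apply Rmult_comm].
    - apply (is_derive_mult V V); [apply DV | apply DV | intros; apply Rmult_comm]. }
  assert (D2 : is_derive (fun t => U t * U t + V t * V t) t 0).
  { apply (is_derive_ext_loc (fun _ => 1)); [|apply (is_derive_const (V := R_NormedModule))].
    assert (Hd : 0 < Rmin (t - a) (b - t)) by (apply Rmin_pos; lra).
    exists (mkposreal _ Hd). intros y Hy. simpl in Hy.
    assert (Hy' := Rabs_def2 _ _ Hy).
    assert (Hm1 := Rmin_l (t - a) (b - t)). assert (Hm2 := Rmin_r (t - a) (b - t)).
    unfold minus, plus, opp in Hy'; simpl in Hy'.
    unfold U, V. rewrite <- Eu, <- Ev, Hunit by lra. reflexivity. }
  apply is_derive_unique in D1. apply is_derive_unique in D2. rewrite D2 in D1.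
  rewrite clamp_id in D1 by lra. unfold U, V in D1. rewrite <- Eu, <- Ev in D1 by lra. lra. }
(* By unit speed, the derivative of the left side is a multiple of [u * u' + v * v'], which is 0 by
   [Horth]. *)
assert (HA : forall t, a <= t <= b -> U t * cos (Th t) + V t * sin (Th t) = 1).
{ intros t Ht. transitivity (U a * cos (Th a) + V a * sin (Th a)).
  - apply (constant_of_derive (fun t => U t * cos (Th t) + V t * sin (Th t)) a b);
      [cts_tac | | assumption].
    intros s Hs.
    assert (E := Horth s Hs). assert (E1 := Hunit s ltac:(lra)).
    assert (Dc : is_derive (fun t => cos (Th t)) s (kap s * - sin (Th s))).
    { apply (is_derive_comp cos Th); [apply is_derive_Reals, derivable_pt_lim_cos | apply DT]. }
    assert (Ds : is_derive (fun t => sin (Th t)) s (kap s * cos (Th s))).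
    { apply (is_derive_comp sin Th); [apply is_derive_Reals, derivable_pt_lim_sin | apply DT]. }
    replace 0 with ((u' (clamp a b s) * cos (Th s) + U s * (kap s * - sin (Th s))) +
      (v' (clamp a b s) * sin (Th s) + V s * (kap s * cos (Th s)))).
    + apply (is_derive_plus (fun t => U t * cos (Th t)) (fun t => V t * sin (Th t))).
      * apply (is_derive_mult U (fun t => cos (Th t))); [apply DU | apply Dc | intros; apply Rmult_comm].
      * apply (is_derive_mult V (fun t => sin (Th t))); [apply DV | apply Ds | intros; apply Rmult_comm].
    + unfold kap, U, V. rewrite <- Eu, <- Ev, !clamp_id by lra.
      transitivity ((u' s * (1 - v s * v s) + u s * v s * v' s) * cos (Th s) +
        (v' s * (1 - u s * u s) + u s * v s * u' s) * sin (Th s)); [ring|].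
      replace (1 - v s * v s) with (u s * u s) by lra.
      replace (1 - u s * u s) with (v s * v s) by lra.
      replace ((u' s * (u s * u s) + u s * v s * v' s) * cos (Th s) +
        (v' s * (v s * v s) + u s * v s * u' s) * sin (Th s))
        with ((u s * u' s + v s * v' s) * (u s * cos (Th s) + v s * sin (Th s))) by ring.
      rewrite E. ring.
  - unfold U, V, Th. rewrite !integral_point, !Rplus_0_r.
    destruct (Hvel a th ltac:(lra) Hth) as [-> ->].
    assert (E := sin2_cos2 th). unfold Rsqr in E. lra. }
intros t Ht. fold (Th t). destruct (Hus t ltac:(lra)) as [th' H].
destruct (Hvel t th' Ht H) as [E1 E2].
assert (A := HA t Ht). unfold U, V in A. rewrite <- Eu, <- Ev in A by assumption.
assert (E3 := sin2_cos2 (Th t)). unfold Rsqr in E3. assert (E4 := Hunit t Ht).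
(* Two unit vectors with inner product 1 coincide. *)
assert (Z : (u t - cos (Th t)) * (u t - cos (Th t)) + (v t - sin (Th t)) * (v t - sin (Th t)) = 0) by lra.
assert (Z1 := Rle_0_sqr (u t - cos (Th t))). assert (Z2 := Rle_0_sqr (v t - sin (Th t))).
unfold Rsqr in Z1, Z2.
apply (heading_ext p t th'); [rewrite <- E1|rewrite <- E2|assumption].
- assert (Z3 : (u t - cos (Th t)) * (u t - cos (Th t)) = 0) by lra.
  apply Rmult_integral in Z3. lra.
- assert (Z3 : (v t - sin (Th t)) * (v t - sin (Th t)) = 0) by lra.
  apply Rmult_integral in Z3. lra.
Qed.

(** The pieces fit because [heading] at a break point is a derivative relative to all of
    [[0, len p]]: the heading that ends one piece can start the next. *)
Lemma heading_lift (rho th : R) (p : path) :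
  unit_speed p -> piecewise_C2_radius_ge rho p -> heading p 0 th ->
  exists Th, cts Th /\ pieces rho Th 0 (len p) /\ Th 0 = th /\
    forall t, 0 <= t <= len p -> heading p t (Th t).
Proof.
intros Hus (n & s & H0 & Hn & Hs) Hth.
assert (Hmon : forall i j, (i + j <= n)%nat -> s i <= s (i + j)%nat).
{ intros i j. induction j as [|j IH]; intros Hj.
  - rewrite Nat.add_0_r. lra.
  - rewrite Nat.add_succ_r. destruct (Hs (i + j)%nat) as [H _]; [lia|].
    specialize (IH ltac:(lia)). lra. }
enough (H : forall i, (i <= n)%nat -> exists Th, cts Th /\ pieces rho Th 0 (s i) /\ Th 0 = th /\
  forall t, 0 <= t <= s i -> heading p t (Th t)).
{ rewrite <- Hn. apply H. lia. }
induction i as [|i IH]; intros Hi.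
- exists (fun _ => th). rewrite H0. repeat split; [apply cts_const | constructor |..];
    replace t with 0 by lra; apply Hth.
- destruct IH as (Th & HC & HP & HT0 & HT); [lia|].
  destruct (Hs i Hi) as [Hlt HC2].
  assert (Hi0 : 0 <= s i) by (rewrite <- H0; apply (Hmon 0%nat i); lia).
  assert (Hin : s (S i) <= len p).
  { rewrite <- Hn. replace n with (S i + (n - S i))%nat by lia. apply Hmon. lia. }
  destruct (heading_piece rho p (s i) (s (S i)) (Th (s i))) as (kap & Ck & Hk & Hhead);
    try assumption; [apply HT; lra|].
  set (Th' := fun t => Th (Rmin t (s i)) + integral kap (s i) (Rmax t (s i))).
  assert (A1 : forall t, t <= s i -> Th' t = Th t).
  { intros t Ht. unfold Th'. rewrite Rmin_left, Rmax_right, integral_point by lra. ring. }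
  assert (A2 : forall t, s i <= t -> Th' t = Th (s i) + integral kap (s i) t).
  { intros t Ht. unfold Th'. rewrite Rmin_right, Rmax_left by lra. reflexivity. }
  exists Th'. split; [|split; [|split]].
  + unfold Th'. apply cts_plus.
    * apply (cts_comp (fun t => Rmin t (s i)) Th); [apply cts_Rmin | assumption].
    * apply (cts_comp (fun t => Rmax t (s i)) (fun t => integral kap (s i) t)); [apply cts_Rmax|].
      apply cts_derive with kap. intros t.
      apply (is_derive_ext (fun t => 0 + integral kap (s i) t)); [intros; apply Rplus_0_l|].
      apply is_derive_integral. assumption.
  + apply pieces_app with (s i).
    * apply (pieces_ext rho Th); [|assumption]. intros t Ht. apply A1. lra.
    * apply pieces_cons with (s (S i)); [assumption| |constructor].
      exists kap. repeat split; try assumption. intros t Ht. rewrite !A2 by lra.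
      rewrite integral_point. ring.
  + rewrite A1 by assumption. assumption.
  + intros t Ht. destruct (Rle_dec t (s i)).
    * rewrite A1 by assumption. apply HT. lra.
    * rewrite A2 by lra. apply Hhead. lra.
Qed.

Definition curve (x y T : R) (Th : R -> R) : path :=
  mkPath T (fun t => x + integral (fun t => cos (Th t)) 0 t)
           (fun t => y + integral (fun t => sin (Th t)) 0 t).

Lemma curve_smooth_piece (rho x y T a b : R) (Th : R -> R) :
  cts Th -> smooth_piece rho Th a b -> C2_radius_ge rho (curve x y T Th) a b.
Proof.
intros HC (kap & Ck & Hk & HTh).
(* Agrees with [Th] on [[a, b]] but is differentiable on the whole line. *)
set (th := fun t => Th a + integral kap a t).
assert (Dth : forall t, is_derive th t (kap t)) by (intros; apply is_derive_integral; assumption).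
assert (Cth : cts th) by (eapply cts_derive; apply Dth).
assert (Dc : forall t, is_derive (fun t => cos (th t)) t (kap t * - sin (th t))).
{ intros t. apply (is_derive_comp cos th); [apply is_derive_Reals, derivable_pt_lim_cos | apply Dth]. }
assert (Ds : forall t, is_derive (fun t => sin (th t)) t (kap t * cos (th t))).
{ intros t. apply (is_derive_comp sin th); [apply is_derive_Reals, derivable_pt_lim_sin | apply Dth]. }
exists (fun t => cos (th t)), (fun t => sin (th t)),
  (fun t => kap t * - sin (th t)), (fun t => kap t * cos (th t)).
repeat split.
- apply (deriv_on_of_derive a b _ (fun t => cos (Th t))).
  + intros t. apply (is_derive_integral (fun t => cos (Th t))). cts_tac.
  + intros t Ht. rewrite (HTh t Ht). reflexivity.
- apply (deriv_on_of_derive a b _ _ _ Dc). reflexivity.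
- apply cont_on_cts. cts_tac.
- apply (deriv_on_of_derive a b _ (fun t => sin (Th t))).
  + intros t. apply (is_derive_integral (fun t => sin (Th t))). cts_tac.
  + intros t Ht. rewrite (HTh t Ht). reflexivity.
- apply (deriv_on_of_derive a b _ _ _ Ds). reflexivity.
- apply cont_on_cts. cts_tac.
- intros t _. assert (E := sin2_cos2 (th t)). unfold Rsqr in E.
  replace (cos (th t) * (kap t * cos (th t)) - sin (th t) * (kap t * - sin (th t)))
    with (kap t * (sin (th t) * sin (th t) + cos (th t) * cos (th t))) by ring.
  rewrite E, Rmult_1_r. apply Hk.
Qed.

Lemma curve_pieces (rho x y T a b : R) (Th : R -> R) :
  cts Th -> pieces rho Th a b ->
  exists (n : nat) (s : nat -> R), s 0%nat = a /\ s n = b /\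
    forall i, (i < n)%nat -> s i < s (S i) /\ C2_radius_ge rho (curve x y T Th) (s i) (s (S i)).
Proof.
intros HC HP. induction HP as [a|a b c Hab Hs Hp (n & s & H0 & Hn & IH)].
- exists 0%nat, (fun _ => a). repeat split; lia.
- exists (S n), (fun i => match i with O => a | S j => s j end). repeat split; [assumption|..];
    destruct i as [|i].
  + rewrite H0. assumption.
  + apply IH. lia.
  + rewrite H0. apply curve_smooth_piece; assumption.
  + apply IH. lia.
Qed.

Definition heading_ok (theta_min theta_max th : R) : Prop :=
  exists k : Z, theta_min <= th + 2 * IZR k * PI <= theta_max.

Lemma cos_sin_shift (th : R) (k : Z) :
  cos (th + 2 * IZR k * PI) = cos th /\ sin (th + 2 * IZR k * PI) = sin th.
Proof.
assert (H : forall n th, cos (th + 2 * IZR (Z.of_nat n) * PI) = cos th /\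
  sin (th + 2 * IZR (Z.of_nat n) * PI) = sin th).
{ intros n x. rewrite <- INR_IZR_INZ. split; [apply cos_period | apply sin_period]. }
destruct (Z_le_gt_dec 0 k) as [Hk|Hk].
- rewrite <- (Z2Nat.id k Hk). apply H.
- destruct (H (Z.to_nat (- k)) (th + 2 * IZR k * PI)) as [H1 H2].
  rewrite Z2Nat.id in H1, H2 by lia. rewrite opp_IZR in H1, H2.
  replace (th + 2 * IZR k * PI + 2 * - IZR k * PI) with th in H1, H2 by ring. auto.
Qed.

Lemma angle_unique (x y : R) : cos x = cos y -> sin x = sin y ->
  exists k : Z, x = y + 2 * IZR k * PI.
Proof.
intros Hc Hs.
assert (H : sin ((x - y) / 2) = 0).
{ assert (E : cos (x - y) = 1).
  { rewrite cos_minus, Hc, Hs. assert (E := sin2_cos2 y). unfold Rsqr in E. lra. }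
  replace (x - y) with (2 * ((x - y) / 2)) in E by field. rewrite cos_2a_sin in E.
  assert (E' : sin ((x - y) / 2) * sin ((x - y) / 2) = 0) by lra.
  apply Rmult_integral in E'. tauto. }
apply sin_eq_0_0 in H. destruct H as [k H]. exists k. lra.
Qed.

(** Turns a heading function into a competing path; the angles [0] and [- (PI / 2)] read off the two
    coordinates of the displacement. *)
Lemma reach_admissible (rho x1 y1 x2 y2 theta_d theta_min theta_max th T : R) (f : R -> R) :
  0 < T -> reach rho theta_d th T f -> heading_ok theta_min theta_max th ->
  f 0 = x2 - x1 -> f (- (PI / 2)) = y2 - y1 ->
  exists q, len q = T /\ admissible rho x1 y1 x2 y2 theta_d theta_min theta_max q.
Proof.
intros HT (Th & HC & HP & H0 & H1 & HF) (k & Hk) Hx Hy.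
exists (curve x1 y1 T Th). split; [reflexivity|].
assert (Dx : forall t, is_derive (px (curve x1 y1 T Th)) t (cos (Th t))).
{ intros t. apply (is_derive_integral (fun t => cos (Th t))). cts_tac. }
assert (Dy : forall t, is_derive (py (curve x1 y1 T Th)) t (sin (Th t))).
{ intros t. apply (is_derive_integral (fun t => sin (Th t))). cts_tac. }
assert (Hh : forall t, heading (curve x1 y1 T Th) t (Th t)).
{ intros t. split; apply is_derive_D_in; [apply Dx | apply Dy]. }
unfold admissible. split; [assumption|].
split; [intros t _; exists (Th t); apply Hh|].
split.
{ exists (fun t => cos (Th t)), (fun t => sin (Th t)). repeat split.
  - apply (deriv_on_of_derive _ _ _ _ _ Dx). reflexivity.
  - apply cont_on_cts. cts_tac.
  - apply (deriv_on_of_derive _ _ _ _ _ Dy). reflexivity.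
  - apply cont_on_cts. cts_tac. }
split; [apply (curve_pieces rho x1 y1 T 0 T Th); assumption|].
simpl. rewrite !integral_point.
split; [ring|]. split; [ring|]. split; [|split; [|split]].
- rewrite (integral_ext _ (fun t => cos (Th t + 0))); [rewrite <- HF, Hx; ring|].
  intros t _. rewrite Rplus_0_r. reflexivity.
- rewrite (integral_ext _ (fun t => cos (Th t + - (PI / 2)))); [rewrite <- HF, Hy; ring|].
  intros t _. fold (Th t - PI / 2). rewrite cos_minus, cos_PI2, sin_PI2. ring.
- rewrite <- H0. apply Hh.
- exists (th + 2 * IZR k * PI). split; [assumption|].
  destruct (cos_sin_shift th k) as [E1 E2].
  apply (heading_ext _ _ th); [symmetry; assumption..|]. rewrite <- H1. apply Hh.
Qed.

Lemma heading_position (p : path) (Th : R -> R) : cts Th -> 0 <= len p ->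
  (forall t, 0 <= t <= len p -> heading p t (Th t)) ->
  forall a t, 0 <= a -> a <= t -> t <= len p ->
    px p t = px p a + integral (fun t => cos (Th t)) a t /\
    py p t = py p a + integral (fun t => sin (Th t)) a t.
Proof.
intros HC Hl HH a t Ha Hat Ht.
split; apply integral_of_D_in with (len p); try lra; try cts_tac.
- intros x Hx. destruct (HH x) as [H _]; [lra|].
  apply (D_in_ext_r _ (fun _ => cos (Th x))); [reflexivity|].
  apply (D_in_restrict _ _ (fun s => 0 <= s <= len p)); [intros; lra | assumption].
- intros x Hx. destruct (HH x) as [_ H]; [lra|].
  apply (D_in_ext_r _ (fun _ => sin (Th x))); [reflexivity|].
  apply (D_in_restrict _ _ (fun s => 0 <= s <= len p)); [intros; lra | assumption].
Qed.

Lemma linear_piece_position (rho : R) (p : path) (Th : R -> R) (a b : R) (k : kind) :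
  0 < rho -> cts Th -> 0 <= len p -> (forall t, 0 <= t <= len p -> heading p t (Th t)) ->
  0 <= a -> b <= len p -> linear_piece rho Th a b k ->
  forall t, a <= t <= b ->
    px p t = px p a + rho * disp1 (Th a) (k, (t - a) / rho) /\
    py p t = py p a + rho * disp1 (Th a - PI / 2) (k, (t - a) / rho).
Proof.
intros Hrho HC Hl HH Ha Hb Hlin t Ht.
destruct (heading_position p Th HC Hl HH a t) as [-> ->]; try lra.
split; f_equal; [rewrite <- (Rplus_0_r (Th a))|change (Th a - PI / 2) with (Th a + - (PI / 2))];
  rewrite <- (integral_linear rho _ a) by assumption;
  (replace (a + rho * ((t - a) / rho)) with t by (field; lra));
  apply integral_ext; rewrite Rmin_left, Rmax_right by lra; intros x Hx.
- rewrite Rplus_0_r, (Hlin x) by lra. reflexivity.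
- fold (Th a + slope k / rho * (x - a) - PI / 2).
  rewrite cos_minus, cos_PI2, sin_PI2, (Hlin x) by lra. ring.
Qed.

Lemma linear_piece_segment (rho : R) (p : path) (Th : R -> R) (a x : R) (k : kind) (w : letter) :
  0 < rho -> cts Th -> 0 <= len p -> (forall t, 0 <= t <= len p -> heading p t (Th t)) ->
  0 <= a -> a + rho * x <= len p -> linear_piece rho Th a (a + rho * x) k ->
  seg_matches (k, x) w -> is_segment rho p a (a + rho * x) w.
Proof.
intros Hrho HC Hl HH Ha Hb Hlin Hm.
assert (Hpos := linear_piece_position rho p Th a _ k Hrho HC Hl HH Ha Hb Hlin).
assert (Ex : (a + rho * x - a) / rho = x) by (field; lra).
destruct k, w as [c|c|]; try easy; simpl; unfold seg_matches in Hm; simpl in Hm.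
- rewrite Ex. split; [assumption|].
  (* The centre lies at distance [rho] along the left normal, and the path is seen from it in the
     direction [Th a - PI / 2]; the right arc has the opposite signs. *)
  exists (px p a - rho * sin (Th a)), (py p a + rho * cos (Th a)), (Th a - PI / 2).
  intros t Ht. destruct (Hpos t Ht) as [-> ->]. unfold disp1; simpl.
  replace (Th a - PI / 2 + (t - a) / rho) with (Th a + (t - a) / rho - PI / 2) by ring.
  rewrite !(sin_minus _ (PI / 2)), (cos_minus _ (PI / 2)), cos_PI2, sin_PI2. split; ring.
- rewrite Ex. split; [assumption|].
  exists (px p a + rho * sin (Th a)), (py p a - rho * cos (Th a)), (Th a + PI / 2).
  intros t Ht. destruct (Hpos t Ht) as [-> ->]. unfold disp1; simpl.
  replace (Th a - PI / 2 - (t - a) / rho) with (Th a - (t - a) / rho - PI / 2) by ring.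
  replace (Th a + PI / 2 - (t - a) / rho) with (Th a - (t - a) / rho + PI / 2) by ring.
  rewrite !(sin_minus _ (PI / 2)), (cos_plus _ (PI / 2)), (sin_plus _ (PI / 2)), cos_PI2, sin_PI2. split; ring.
- exists (Th a). intros t Ht. destruct (Hpos t Ht) as [-> ->]. unfold disp1; simpl.
  rewrite cos_minus, cos_PI2, sin_PI2. split; field; lra.
Qed.

Lemma follows_spells (rho : R) (p : path) (Th : R -> R) (a : R) (l : list seg) (w : list letter) :
  0 < rho -> cts Th -> 0 <= len p -> (forall t, 0 <= t <= len p -> heading p t (Th t)) ->
  0 <= a -> follows rho Th a l (len p) -> Forall2 seg_matches l w -> spells rho p a w.
Proof.
intros Hrho HC Hl HH Ha Hf Hm. revert a Ha Hf.
induction Hm as [|[k x] c l w Hc Hm IH]; intros a Ha Hf; [assumption|].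
destruct Hf as (Hx & Hlin & Hf). simpl in Hx, Hlin, Hf.
assert (Hrx : 0 < rho * x) by (apply Rmult_lt_0_compat; assumption).
assert (Hend : a + rho * x <= len p).
{ destruct (follows_reach rho Th _ _ _ Hrho HC Hf) as [E _]. rewrite E.
  assert (H := tot_nonneg l (all_pos_valid l (follows_all_pos _ _ _ _ _ Hf))).
  assert (0 <= rho * tot l) by (apply Rmult_le_pos; lra). lra. }
exists (a + rho * x). split; [lra|split].
- apply (linear_piece_segment rho p Th a x k); assumption.
- apply IH; [lra | assumption].
Qed.

Theorem theorem2 (rho x1 y1 x2 y2 theta_d theta_min theta_max : R)
  (Hrho : 0 < rho)
  (Hmin : 0 <= theta_min) (Hlt : theta_min < theta_max)
  (Hmax : theta_max <= 2 * PI)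
  (p : path)
  (Hp : shortest rho x1 y1 x2 y2 theta_d theta_min theta_max p) :
  (of_type_or_degenerate rho p [Lt; St] \/
   of_type_or_degenerate rho p [Rt; St] \/
   of_type_or_degenerate rho p [Lt; Rt_gtPI] \/
   of_type_or_degenerate rho p [Rt; Lt_gtPI])
  \/
  (heading p (len p) theta_max /\
   (of_type_or_degenerate rho p [Lt; St; Rt] \/
    of_type_or_degenerate rho p [Rt; St; Rt] \/
    of_type_or_degenerate rho p [Rt; Lt_gtPI; Rt]))
  \/
  (heading p (len p) theta_min /\
   (of_type_or_degenerate rho p [Rt; St; Lt] \/
    of_type_or_degenerate rho p [Lt; St; Lt] \/
    of_type_or_degenerate rho p [Lt; Rt_gtPI; Lt])).
Proof.
destruct Hp as [(Hlen & Hus & _ & Hpw & Hx1 & Hy1 & Hx2 & Hy2 & Hd & theta_a & Ha & Hha) Hshort].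
destruct (heading_lift rho theta_d p Hus Hpw Hd) as (Th & HC & HP & H0 & HH).
assert (Hl : 0 <= len p) by lra.
set (ok := heading_ok theta_min theta_max).
assert (Hper : forall y, ok (Th 0 + (y + 2 * PI)) <-> ok (Th 0 + y)).
{ intros y. split; intros [k Hk]; [exists (k + 1)%Z|exists (k - 1)%Z];
    rewrite ?plus_IZR, ?minus_IZR; lra. }
destruct (heading_unique p (len p) theta_a (Th (len p))) as [Ec Es]; [lra|lra|assumption|apply HH; lra|].
(* The lifted final heading may differ from [theta_a] by [k] full turns; fixing [k] carries the
   distances of [theta_a] from [theta_min] and [theta_max] over to the lift. *)
destruct (angle_unique theta_a (Th (len p)) Ec Es) as [k Hk].
assert (Hok : forall x, theta_min <= x + 2 * IZR k * PI <= theta_max -> ok x) by (intros x Hx; exists k; assumption).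
assert (HokT : ok (Th (len p))) by (apply Hok; lra).
destruct (heading_position p Th HC Hl HH 0 (len p)) as [Ex Ey]; try lra.
assert (HM : minimal rho ok Th (len p)).
{ intros T' th f HT' Hr Hf Hokth.
  destruct (reach_admissible rho x1 y1 x2 y2 theta_d theta_min theta_max th T' f) as (q & <- & Hq);
    try assumption.
  - rewrite <- H0. assumption.
  - rewrite Hf, <- Hx1, <- Hx2, Ex. rewrite (integral_ext _ (fun t => cos (Th t))); [ring|].
    intros t _. rewrite Rplus_0_r. reflexivity.
  - rewrite Hf, <- Hy1, <- Hy2, Ey. rewrite (integral_ext _ (fun t => sin (Th t))); [ring|].
    intros t _. fold (Th t - PI / 2). rewrite cos_minus, cos_PI2, sin_PI2. ring.
  - apply Hshort. assumption. }
destruct (minimal_follows rho ok Th (len p) Hrho HC HP HokT HM) as (l & Hf & Hdist).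
assert (Hopt := minimal_optimal rho ok Th (len p) l Hrho HC HokT HM Hf).
assert (Hpos := follows_all_pos rho Th 0 (len p) l Hf).
destruct (follows_reach rho Th 0 (len p) l Hrho HC Hf) as (HT & HA & _).
assert (Hne : l <> []).
{ intros ->. simpl in HT. lra. }
assert (Hof : forall w, has_type l w -> of_type_or_degenerate rho p w).
{ intros w (w' & Hw & Hm). exists w'. split; [assumption|].
  apply (follows_spells rho p Th 0 l w'); try assumption; lra. }
assert (Hfree : free_shape l ->
  of_type_or_degenerate rho p [Lt; St] \/ of_type_or_degenerate rho p [Rt; St] \/
  of_type_or_degenerate rho p [Lt; Rt_gtPI] \/ of_type_or_degenerate rho p [Rt; Lt_gtPI]).
{ intros [H|[H|[H|H]]]; apply Hof in H; tauto. }
destruct (optimal_shape (fun x => ok (Th 0 + x)) l Hper Hopt Hpos Hdist Hne) as (S1 & S2 & S3).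
(* The distance from [theta_a] to [theta_min] is the allowance for decreasing the final heading;
   [Hasc] is the same after a reflection. *)
assert (Hdesc : theta_min < theta_a -> descending_end l).
{ intros H. apply (optimal_descending_end (fun x => ok (Th 0 + x))); try assumption.
  exists (theta_a - theta_min). split; [lra|]. intros x Hx. apply Hok. lra. }
assert (Hasc : theta_a < theta_max -> descending_end (mirror l)).
{ intros H. apply (optimal_descending_end (fun x => ok (Th 0 + - x))).
  - intros y. rewrite <- (Hper (- (y + 2 * PI))).
    replace (- (y + 2 * PI) + 2 * PI) with (- y) by ring. reflexivity.
  - apply (optimal_mirror (fun x => ok (Th 0 + x))). assumption.
  - apply (Forall_mirror (fun x => 0 < x)). assumption.
  - apply (can_ascend_mirror (fun x => ok (Th 0 + x))).
    exists (theta_max - theta_a). split; [lra|]. intros x Hx. apply Hok. lra. }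
(* As [theta_min < theta_max], the arrival heading can move inwards from either end of the interval,
   and both ways from its interior. *)
destruct (Req_dec theta_a theta_max) as [Emax|Nmax]; [|destruct (Req_dec theta_a theta_min) as [Emin|Nmin]].
- destruct S1 as [S1|S1]; [apply Hdesc; lra | left; auto |].
  right; left. split; [rewrite <- Emax; assumption|].
  destruct S1 as [H|[H|H]]; apply Hof in H; tauto.
- destruct S2 as [S2|S2]; [apply Hasc; lra | left; auto |].
  right; right. split; [rewrite <- Emin; assumption|].
  destruct S2 as [H|[H|H]]; apply Hof in H; tauto.
- left. apply Hfree, S3; [apply Hdesc | apply Hasc]; lra.
Qed.
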